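(* (a) Let $\mathcal{F}$ be a consistent family of encodings of a nested family of Hilbert spaces $\{\mathcal{H}^{E_i}\}$, and $\Psi=\{|\psi_i\rangle\}$ with $|\psi_i\rangle\in\mathcal{H}^{E_i}$. Then $\Psi$ is an encoded universal resource with respect to $\mathcal{F}$ up to logical Pauli operators if and only if, for every $d$, an encoded (with respect to $\mathcal{F}$) 2D cluster state $|\mathbf{C}_{d\times d}\rangle$ can be generated from some member of $\Psi$ by LOCC up to logical Pauli operations. (b) $\Psi$ is an encoded universal resource up to logical Pauli operators if and only if there exists a consistent family of encodings such that encoded 2D cluster states $|\mathbf{C}_{d\times d}\rangle$ of arbitrary $d$ can be generated from $\Psi$ by LOCC up to logical Pauli operations.
   Context: An $m$-qubit encoding of an $n$-qubit system consists of a set $E$ of $mn$ qubits, a partition $\mathcal{P}=\{A_1,\dots,A_n\}$ of $E$ into blocks of $m$ qubits, and two fixed orthogonal $m$-qubit states $|\mathbf0\rangle,|\mathbf1\rangle$; the encoded version of $|\phi\rangle=\sum c_{i_1\dots i_n}|i_1\dots i_n\rangle$ is $|\boldsymbol\phi\rangle=\sum c_{i_1\dots i_n}|\mathbf{i}_1\rangle_{A_1}\cdots|\mathbf{i}_n\rangle_{A_n}$, and for a one-qubit operator $U=\sum_{a,b}u_{ab}|a\rangle\langle b|$ its logical version is $\mathbf U=\sum_{a,b}u_{ab}|\mathbf a\rangle\langle\mathbf b|$, acting on a block. A nested family of Hilbert spaces is $\{\mathcal H^{E_i}\}$ with $E_i$ a finite set of qubits and $E_i\subseteq E_{i+1}$.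 A consistent family of encodings is $\mathcal F=\{\mathcal E_1,\mathcal E_2,\dots\}$, $\mathcal E_i$ an $m$-qubit encoding of $\mathcal H^{E_i}$ (fixed $m$ and fixed $|\mathbf0\rangle,|\mathbf1\rangle$) with partition $\mathcal P_i$ of $E_i$ into blocks, such that $\mathcal P_i\subseteq\mathcal P_{i+1}$. ''Generated by LOCC up to logical Pauli operations'': starting from $|\psi_i\rangle$, an LOCC protocol on the physical qubits (each physical qubit a party) exactly and with probability one yields, on a fixed set of $n$ blocks of $\mathcal P_i$, the state $(\mathbf P_1\otimes\cdots\otimes\mathbf P_n)|\boldsymbol\phi\rangle$ where each $\mathbf P_k$ is a logical Pauli operator ($\mathbf 1,\boldsymbol\sigma_x,\boldsymbol\sigma_y,\boldsymbol\sigma_z$) possibly depending on the branch, the remaining qubits being in $|0\rangle$. $\Psi$ is encoded universal w.r.t. $\mathcal F$ up to logical Pauli operators if every $n$-qubit $|\phi\rangle$ (every $n$) can be so generated from some $|\psi_i\rangle$ (encoded w.r.t. $\mathcal E_i$). The 2D cluster state $|C_{d\times d}\rangle$ is the graph state (joint $+1$ eigenstate of $\sigma_x^{(a)}\prod_{b\sim a}\sigma_z^{(b)}$) of the $d\times d$ grid graph. *)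

(* Defs.v *)
From HB Require Import structures.
From mathcomp Require Import all_boot all_order all_algebra.
From mathcomp Require Import finmap.
Set Implicit Arguments. Unset Strict Implicit. Unset Printing Implicit Defensive.
Import Order.TTheory GRing.Theory Num.Theory.
Local Open Scope fset_scope.
Local Open Scope ring_scope.

Section Defs.
Variable C : numClosedFieldType.

(* Physical qubits are labelled by natural numbers.  A computational   *)
(* basis configuration is the finite set S of qubits that are in |1>.  *)
(* A (possibly unnormalized) vector is a function of configurations;   *)
(* it lies in H^E when its support consists of subsets of E (all       *)
(* qubits outside E are in |0>).                                       *)
Definition qstate := {fset nat} -> C.

Definition supported (E : {fset nat}) (psi : qstate) : Prop :=
  forall S, psi S != 0 -> S `<=` E.

Definition normalized_in (E : {fset nat}) (psi : qstate) : Prop :=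
  \sum_(S <- fpowerset E) `|psi S| ^+ 2 = 1.

Definition b2o (b : bool) : 'I_2 := if b then ord_max else ord0.

Definition apply1 (K : 'M[C]_2) (q : nat) (psi : qstate) : qstate :=
  fun S => \sum_(b < 2)
     K (b2o (q \in S)) b * psi (if val b == 1%N then q |` S else S `\ q).

Definition adjmx (K : 'M[C]_2) : 'M[C]_2 := (map_mx Num.conj K)^T.

(* LOCC protocols (each physical qubit is a party): a finite tree; at  *)
(* each node one party q performs a local instrument with Kraus        *)
(* operators K_1..K_r on its qubit (sum K^dag K = 1), the outcome is    *)
(* broadcast and the protocol continues with the chosen subtree.       *)
Inductive locc : Type :=
  | Done
  | Meas of nat & seq ('M[C]_2 * locc).

(* [runs E p psi G]: every branch of p occurring with nonzero           *)
(* probability when started on psi ends in a state satisfying G.       *)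
Fixpoint runs (E : {fset nat}) (p : locc) (psi : qstate)
    (G : qstate -> Prop) {struct p} : Prop :=
  match p with
  | Done => G psi
  | Meas q br =>
      q \in E /\
      \sum_(kb <- br) adjmx kb.1 *m kb.1 = 1%:M /\
      (fix F (l : seq ('M[C]_2 * locc)) : Prop :=
         match l with
         | [::] => True
         | (K, p') :: l' =>
             ((apply1 K q psi = fun _ => 0) \/ runs E p' (apply1 K q psi) G)
             /\ F l'
         end) br
  end.

Definition lstate (n : nat) := {ffun 'I_n -> bool} -> C.

Definition lnormalized n (phi : lstate n) : Prop :=
  \sum_(x : {ffun 'I_n -> bool}) `|phi x| ^+ 2 = 1.

Definition lapply1 n (U : 'M[C]_2) (k : 'I_n) (phi : lstate n) : lstate n :=
  fun x => \sum_(b < 2)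
     U (b2o (x k)) b * phi [ffun j => if j == k then val b == 1%N else x j].

Definition sigma_x : 'M[C]_2 := \matrix_(i, j) (i != j)%:R.
Definition sigma_y : 'M[C]_2 :=
  \matrix_(i, j) (if i == j then 0 else if i == ord0 then - 'i else 'i).
Definition sigma_z : 'M[C]_2 :=
  \matrix_(i, j) (if i == j then (if i == ord0 then 1 else -1) else 0).

Definition pauli (a : 'I_4) : 'M[C]_2 :=
  match val a with
  | 0%N => 1%:M
  | 1%N => sigma_x
  | 2%N => sigma_y
  | _ => sigma_z
  end.

Definition apply_paulis n (ps : n.-tuple 'I_4) (phi : lstate n) : lstate n :=
  foldr (fun k acc => lapply1 (pauli (tnth ps k)) k acc) phi (enum 'I_n).

(* Encodings.  A block is an ordered m-tuple of distinct physical      *)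
(* qubits; |0>,|1> are fixed m-qubit states (functions of m bits).     *)
Record enc_family := EncFamily {
  ef_m : nat;
  ef_L0 : lstate ef_m;
  ef_L1 : lstate ef_m;
  ef_P : nat -> {fset ef_m.-tuple nat}
}.

Arguments ef_m : clear implicits.
Arguments ef_L0 : clear implicits.
Arguments ef_L1 : clear implicits.
Arguments ef_P : clear implicits.

Definition lip n (u v : lstate n) : C :=
  \sum_(x : {ffun 'I_n -> bool}) (u x)^* * v x.

Definition is_partition m (E : {fset nat}) (P : {fset m.-tuple nat}) : Prop :=
  (forall b, b \in P -> uniq b /\ all (fun q => q \in E) b) /\
  (forall q, q \in E -> exists2 b, b \in P & q \in (b : seq nat)) /\
  (forall b b', b \in P -> b' \in P -> b != b' ->
     forall q, q \in (b : seq nat) -> q \notin (b' : seq nat)).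

Definition nested (E : nat -> {fset nat}) : Prop := forall i, E i `<=` E i.+1.

Definition consistent (E : nat -> {fset nat}) (F : enc_family) : Prop :=
  lnormalized (ef_L0 F) /\ lnormalized (ef_L1 F) /\
  lip (ef_L0 F) (ef_L1 F) = 0 /\
  (forall i, is_partition (E i) (ef_P F i) /\ ef_P F i `<=` ef_P F i.+1).

Definition block_bits m (b : m.-tuple nat) (S : {fset nat}) : {ffun 'I_m -> bool} :=
  [ffun j => tnth b j \in S].

(* the encoded state |phi> on the blocks A_1..A_n, all other qubits |0> *)
Definition enc_state (F : enc_family) n (A : n.-tuple ((ef_m F).-tuple nat))
    (phi : lstate n) : qstate :=
  fun S =>
    if all (fun q => has (fun b : (ef_m F).-tuple nat => q \in (b : seq nat)) A)
           (enum_fset S)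
    then \sum_(x : {ffun 'I_n -> bool})
           phi x * \prod_(k < n)
             (if x k then ef_L1 F else ef_L0 F) (block_bits (tnth A k) S)
    else 0.

Definition generates (E : nat -> {fset nat}) (F : enc_family)
    (psi : nat -> qstate) (i n : nat) (phi : lstate n) : Prop :=
  exists A : n.-tuple ((ef_m F).-tuple nat),
    (forall k, tnth A k \in ef_P F i) /\ uniq A /\
    exists p : locc,
      runs (E i) p (psi i)
        (fun chi => exists2 c : C, c != 0 &
           exists ps : n.-tuple 'I_4,
             chi = fun S => c * enc_state A (apply_paulis ps phi) S).

Definition universal (E : nat -> {fset nat}) (F : enc_family)
    (psi : nat -> qstate) : Prop :=
  forall n (phi : lstate n), lnormalized phi ->
    exists i, generates E F psi i phi.

(* 2D cluster states: vertex k of 'I_(d*d) is grid point (k/d, k%d).   *)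
Definition grid_adj d (u v : 'I_(d * d)) : bool :=
  let ru := (u %/ d)%N in let cu := (u %% d)%N in
  let rv := (v %/ d)%N in let cv := (v %% d)%N in
  ((ru == rv) && ((cu.+1 == cv) || (cv.+1 == cu))) ||
  ((cu == cv) && ((ru.+1 == rv) || (rv.+1 == ru))).

Definition cluster_stab d (a : 'I_(d * d)) (phi : lstate (d * d)) : lstate (d * d) :=
  lapply1 sigma_x a
    (foldr (fun b acc => lapply1 sigma_z b acc) phi
       [seq b <- enum 'I_(d * d) | grid_adj a b]).

Definition is_cluster d (phi : lstate (d * d)) : Prop :=
  lnormalized phi /\ forall a, cluster_stab a phi = phi.

Definition cluster_generable (E : nat -> {fset nat}) (F : enc_family)
    (psi : nat -> qstate) : Prop :=
  forall d, exists phi : lstate (d * d),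
    is_cluster phi /\ exists i, generates E F psi i phi.

Definition resource_family (E : nat -> {fset nat}) (psi : nat -> qstate) : Prop :=
  forall i, supported (E i) (psi i) /\ normalized_in (E i) (psi i).

End Defs.

(* Main.v *)
Require Import Defs.
From HB Require Import structures.
From mathcomp Require Import all_boot all_order all_algebra.
From mathcomp Require Import finmap reals complex.
From mathcomp Require Import boolp zify ring.
Set Implicit Arguments. Unset Strict Implicit. Unset Printing Implicit Defensive.
Import Order.TTheory GRing.Theory Num.Theory.
Local Open Scope fset_scope.
Local Open Scope ring_scope.

(** A graph-state cluster is universal because single-qubit measurements drive
    any circuit on it, and two orthogonal code words of a block can be told apart
    by local measurements, so that every logical measurement can be carried out
    by LOCC on the physical qubits of the block.

    Logical qubit [k] travels along row [2k] of the grid.  Measuring a wire vertex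
    in the basis [(1, +-w)] moves the qubit one column to the right and applies
    [H diag(1, w)]; measuring a vertex off the wires in the Y-Z plane applies
    [exp (i theta Z_N)] to its neighbourhood [N], which for [theta = 0] deletes the
    vertex and otherwise couples two neighbouring wires.  All byproducts are
    Pauli strings, and these only change the basis of later measurements.

    The resulting gates contain [H] and [CZ], hence CNOT, which conjugates
    [exp (i theta Z_k)] into [exp (i theta Z_S)] for every [S]; products of these
    are all diagonal unitaries, and two diagonals interleaved with [H_k] rotate
    any state into the subspace where bit [k] is [0].  Thus every state is
    connected to [|0...0>] by a circuit of such gates. *)

(** * Local discrimination of orthogonal states *)

Section Reachability.
Variables (C : numClosedFieldType) (E : {fset nat}).
Implicit Types (psi chi : qstate C) (G : qstate C -> Prop).

(* Branches of probability zero put no constraint on a protocol, so the zero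
   vector reaches everything. *)
Definition reaches psi G : Prop :=
  psi = (fun _ => 0) \/ exists p, runs E p psi G.

Lemma reaches_done psi G : G psi -> reaches psi G.
Proof. by move=> Gpsi; right; exists (@Done C). Qed.

Lemma reaches_meas q (Ks : seq 'M[C]_2) psi G :
  q \in E -> \sum_(K <- Ks) adjmx K *m K = 1%:M ->
  (forall K, K \in Ks -> reaches (apply1 K q psi) G) -> reaches psi G.
Proof.
move=> qE sumK reachK; right.
pose branches := fix F (l : seq ('M[C]_2 * locc C)) : Prop :=
  match l with
  | [::] => True
  | (K, p') :: l' =>
    ((apply1 K q psi = fun _ => 0) \/ runs E p' (apply1 K q psi) G) /\ F l'
  end.
suff [br brK brP] : exists2 br, unzip1 br = Ks & branches br.
  exists (Meas q br); split=> //; split=> //.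
  by rewrite -[RHS]sumK -brK big_map.
elim: Ks {sumK} reachK => [|K Ks IH] reachK; first by exists [::].
have [|br brK brP] := IH; first by move=> K' K'in; apply: reachK; rewrite inE K'in orbT.
have [K0|[p pP]] := reachK K (mem_head _ _).
  by exists ((K, Done C) :: br); [rewrite /= brK | split=> //; left].
by exists ((K, p) :: br); [rewrite /= brK | split=> //; right].
Qed.

Lemma runs_bind p psi G G' :
  runs E p psi G -> (forall chi, G chi -> reaches chi G') -> reaches psi G'.
Proof.
(* [locc] is nested through [seq], so the recursion into subtrees is set up by hand; the
   continuations are grafted onto the leaves. *)
move=> + bind; move: p psi; fix IH 1 => -[|q br] psi; first exact: bind.
move=> [qE [sumK brP]].
apply: (@reaches_meas q (unzip1 br)) => //; first by rewrite big_map.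
elim: br brP {sumK} => [|[K p] br IHbr] //= [hK hbr] K'.
rewrite inE => /orP[/eqP->|]; last exact: IHbr.
case: hK => [->|hK]; first by left.
exact: IH hK.
Qed.

Lemma reaches_bind psi G G' :
  reaches psi G -> (forall chi, G chi -> reaches chi G') -> reaches psi G'.
Proof. by move=> [->|[p /runs_bind h] /h//]; left. Qed.

End Reachability.

(** * Telling two orthogonal block states apart qubit by qubit *)

Section LocalDiscrimination.
Variables (C : numClosedFieldType) (E : {fset nat}).

(** A traceless 2x2 matrix has zero in its numerical range. After division by [a], a phase [z] makes
    the cross terms real, and what remains is a real quadratic equation. *)
Lemma isotropic_vector (a b c : C) : exists x y : C,
  x * x^* + y * y^* = 1 /\
  a * (x * x^* - y * y^*) + b * (x * y^*) + c * (x^* * y) = 0.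
Proof.
have [->|a0] := eqVneq a 0.
  by exists 1, 0; split; rewrite !(rmorph1, rmorph0); ring.
pose be := b / a; pose ga := c / a.
(* [z] is chosen of modulus one with [be z^* + ga z] real *)
have [z [zz zr]] : exists z : C, z * z^* = 1 /\
    be * z^* + ga * z = be^* * z + ga^* * z^*.
  (* The reality condition says that [de * z^*] is real, so [z] is the phase of [de]. *)
  pose de := be - ga^*.
  have [de0|de0] := eqVneq de 0.
    exists 1; split; rewrite rmorph1 !mulr1 //.
    have -> : be = ga^* by apply/eqP; rewrite -subr_eq0 -/de de0.
    by rewrite conjCK addrC.
  exists (de / `|de|).
  have nd : `|de| != 0 by rewrite normr_eq0.
  have cd : (de / `|de|)^* = de^* / `|de|.
    by rewrite rmorphM fmorphV /= conj_normC.
  rewrite cd; split.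
    rewrite mulrACA -normCK -invfM -expr2 divff // expf_neq0 //.
  have -> : de^* = be^* - ga by rewrite /de rmorphB /= conjCK.
  by rewrite /de; field.
pose r := be * z^* + ga * z.
have rreal : r^* = r.
  by rewrite {1}/r rmorphD (rmorphM _ be) (rmorphM _ ga) /= conjCK /r zr.
have rR : r \is Num.real by apply/CrealP.
(* For [x = s / N] and [y = z / N] the form is proportional to [s^2 + r s - 1], whose discriminant
   [r^2 + 4] is positive. *)
pose D := sqrtC (r ^+ 2 + 4).
have D2 : D ^+ 2 = r ^+ 2 + 4 by rewrite sqrtCK.
have Dc : D^* = D.
  apply/CrealP; rewrite realE sqrtC_ge0 addr_ge0 //.
  by rewrite real_exprn_even_ge0.
pose s := (D - r) / 2.
have sc : s^* = s by rewrite /s rmorphM fmorphV rmorphB rmorph_nat /= Dc rreal.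
have s2 : s ^+ 2 + r * s - 1 = 0.
  have -> : s ^+ 2 + r * s - 1 = (D ^+ 2 - r ^+ 2 - 4) / 4 by rewrite /s; field.
  by rewrite D2; field.
clearbody s; have sR : s \is Num.real by apply/CrealP.
have n0 : 0 < s ^+ 2 + 1 by rewrite ltr_wpDl // real_exprn_even_ge0.
pose N := sqrtC (s ^+ 2 + 1).
have N2 : N ^+ 2 = s ^+ 2 + 1 by rewrite sqrtCK.
have N0 : N != 0 by rewrite sqrtC_eq0 gt_eqF.
have Nc : N^* = N by apply/CrealP; rewrite realE sqrtC_ge0 ltW.
clearbody N; exists (s / N), (z / N).
rewrite !rmorphM !fmorphV /= sc Nc; split.
  have -> : s / N * (s / N) + z / N * (z^* / N) = (s ^+ 2 + z * z^*) / N ^+ 2 by field.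
  by rewrite zz N2 divff // gt_eqF.
have -> : b = a * be by rewrite /be mulrC divfK.
have -> : c = a * ga by rewrite /ga mulrC divfK.
have -> : a * (s / N * (s / N) - z / N * (z^* / N)) +
  a * be * (s / N * (z^* / N)) + a * ga * (s / N * (z / N)) =
  a * (s ^+ 2 + r * s - z * z^*) / N ^+ 2 by rewrite /r; field.
by rewrite zz s2 mulr0 mul0r.
Qed.

(** The Kraus operator that applies the bra [(p0, p1)] and prepares |0>: qubits of measured blocks
    have to end in |0>. *)
Definition reset_bra (p0 p1 : C) : 'M[C]_2 :=
  \matrix_(i, j) (if i == ord0 then if j == ord0 then p0 else p1 else 0).

Lemma apply1_reset p0 p1 q (psi : qstate C) S :
  apply1 (reset_bra p0 p1) q psi S =
  if q \in S then 0 else p0 * psi S + p1 * psi (q |` S).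
Proof.
rewrite /apply1 !big_ord_recl big_ord0 addr0 !mxE -!val_eqE /=.
case: (boolP (q \in S)) => qS /=; first by rewrite !mul0r addr0.
by congr (_ * psi _ + _); apply/fsetP=> x; rewrite !inE; case: eqP => // ->; rewrite (negPf qS).
Qed.

Lemma reset_bra_complete (x y : C) : x * x^* + y * y^* = 1 ->
  \sum_(K <- [:: reset_bra x^* y^*; reset_bra (- y) x]) adjmx K *m K = 1%:M.
Proof.
move=> nrm; rewrite !big_cons big_nil addr0; apply/matrixP=> i j.
rewrite !mxE !big_ord_recl !big_ord0 !mxE /=.
case: (unliftP ord0 i) => [i'|] -> /=; case: (unliftP ord0 j) => [j'|] -> /=;
  rewrite ?(ord1 i') ?(ord1 j') -?val_eqE /= ?rmorphN ?rmorph0 /= ?conjCK -?nrm; ring.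
Qed.

Definition bits (b : seq nat) (S : {fset nat}) : seq bool := [seq q \in S | q <- b].

Definition fsetoff (b : seq nat) (S : {fset nat}) : {fset nat} :=
  [fset q in S | q \notin b].

Definition bip m (u v : seq bool -> C) : C := \sum_(t : m.-tuple bool) (u t)^* * v t.

Lemma bip0 u v : bip 0 u v = (u [::])^* * v [::].
Proof.
rewrite /bip (big_pred1 [tuple]) // => t.
by rewrite [t]tuple0 /= eqxx.
Qed.

Lemma sum_tupleS m (F : seq bool -> C) :
  \sum_(t : m.+1.-tuple bool) F t = \sum_(b : bool) \sum_(t : m.-tuple bool) F (b :: t).
Proof.
rewrite pair_big /=.
rewrite (reindex (fun p : bool * m.-tuple bool => [tuple of p.1 :: p.2])) //=.
exists (fun t => (thead t, [tuple of behead t])) => [[b t] _|t _] /=.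
  by congr (_, _); apply/val_inj.
by rewrite -tuple_eta.
Qed.

Lemma bipS m u v :
  bip m.+1 u v = \sum_(b : bool) bip m (fun s => u (b :: s)) (fun s => v (b :: s)).
Proof. exact: (sum_tupleS _ (fun s => (u s)^* * v s)). Qed.

(** The overlap after a bra on the first qubit is the sesquilinear form of the matrix [M] of
    residual overlaps; the trace of [M] is the overlap before the measurement. *)
Lemma bip_bra m (u v : seq bool -> C) p0 p1 :
  let cut w s := p0 * w (false :: s) + p1 * w (true :: s) in
  let M i j := bip m (fun s => u (i :: s)) (fun s => v (j :: s)) in
  bip m (cut u) (cut v) =
  p0^* * p0 * M false false + p0^* * p1 * M false true +
  p1^* * p0 * M true false + p1^* * p1 * M true true.
Proof.
rewrite /bip /= !mulr_sumr -!big_split; apply: eq_bigr => t _ /=.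
by rewrite rmorphD !rmorphM; ring.
Qed.

(* Walgate et al.: a basis in which the traceless matrix of overlaps of the
   residual states has zero diagonal keeps the two alternatives orthogonal after
   each local measurement; once the block is exhausted, one of them is excluded. *)
Lemma local_discrimination (b : seq nat) (u : bool -> seq bool -> C)
    (R : bool -> qstate C) G :
  uniq b -> all (fun q => q \in E) b ->
  bip (size b) (u false) (u true) = 0 ->
  (forall o S q, q \in b -> q \in S -> R o S = 0) ->
  (forall o c, c != 0 -> reaches E (fun S => c * R o S) G) ->
  reaches E (fun S => \sum_(o : bool) u o (bits b S) * R o (fsetoff b S)) G.
Proof.
elim: b u => [|q b IH] u /=.
  move=> _ _ /eqP; rewrite bip0 mulf_eq0 conjC_eq0 => u0 _ reachR.
  have off S : fsetoff [::] S = S by apply/fsetP=> x; rewrite !inE andbT.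
  suff [o ->] : exists o, (fun S => \sum_(o : bool) u o (bits [::] S) * R o (fsetoff [::] S)) =
     (fun S => u o [::] * R o S).
    have [uo|uo] := eqVneq (u o [::]) 0; last exact: reachR.
    by left; apply: funext => S; rewrite uo mul0r.
  case/orP: u0 => /eqP u0; [exists true|exists false];
    by apply: funext => S; rewrite big_bool /= !off u0 mul0r ?addr0 ?add0r.
move=> /andP[qb ub] /andP[qE bE] orth R0 reachR.
pose M i j := bip (size b) (fun s => u false (i :: s)) (fun s => u true (j :: s)).
move: orth; rewrite bipS big_bool /= -/(M true true) -/(M false false) => trM.
have [x [y [nrm iso]]] := isotropic_vector (M false false) (M false true) (M true false).
have Mtt : M true true = - M false false by apply/eqP; rewrite -addr_eq0 trM.
have step p0 p1 : p0^* * p0 * M false false + p0^* * p1 * M false true +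
    p1^* * p0 * M true false + p1^* * p1 * M true true = 0 ->
    reaches E (apply1 (reset_bra p0 p1) q
       (fun S => \sum_(o : bool) u o (bits (q :: b) S) * R o (fsetoff (q :: b) S))) G.
  move=> Mp.
  have -> : apply1 (reset_bra p0 p1) q
       (fun S => \sum_(o : bool) u o (bits (q :: b) S) * R o (fsetoff (q :: b) S)) =
     (fun S => \sum_(o : bool) (p0 * u o (false :: bits b S) + p1 * u o (true :: bits b S))
         * R o (fsetoff b S)).
    apply: funext => S; rewrite apply1_reset.
    (* On configurations containing [q] the reset makes one side zero, and [R0] makes the other side
       zero. *)
    case: ifPn => qS.
      rewrite big1 // => o _; rewrite (R0 o _ q) ?mulr0 ?mem_head // !inE qS qb //.
    rewrite !mulr_sumr -big_split; apply: eq_bigr => o _ /=.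
    have -> : fsetoff (q :: b) S = fsetoff b S.
      by apply/fsetP=> z; rewrite !inE; case: eqP => [->|]; rewrite ?(negPf qS).
    have -> : fsetoff (q :: b) (q |` S) = fsetoff b S.
      by apply/fsetP=> z; rewrite !inE; case: eqP => [->|]; rewrite ?(negPf qS).
    have -> : bits b (q |` S) = bits b S.
      apply/eq_in_map=> z zb; rewrite !inE; case: eqP => // zq.
      by rewrite -zq zb in qb.
    by rewrite fset1U1 (negPf qS) mulrDl !mulrA.
  apply: (IH (fun o s => p0 * u o (false :: s) + p1 * u o (true :: s))) => //.
    by rewrite bip_bra -[RHS]Mp.
  by move=> o S z zb; apply: R0; rewrite inE zb orbT.
apply: (reaches_meas qE (reset_bra_complete nrm)) => K; rewrite !inE.
(* On the bra orthogonal to an isotropic one, a traceless form takes the opposite value, again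
   zero. *)
case/orP=> /eqP->; apply: step; rewrite Mtt ?rmorphN /= ?conjCK.
  by rewrite -[RHS]iso; ring.
by rewrite -[RHS]oppr0 -iso; ring.
Qed.

End LocalDiscrimination.

(** * Logical measurements of encoded graph states *)

Section BitStrings.
Variable V : finType.
Implicit Types (x y a b : {ffun V -> bool}) (D : {set V}) (u v : V).

Definition xset v o x : {ffun V -> bool} := [ffun u => if u == v then o else x u].
Definition xadd x a : {ffun V -> bool} := [ffun u => x u (+) a u].
Definition xone v : {ffun V -> bool} := [ffun u => u == v].
Definition xzero : {ffun V -> bool} := [ffun=> false].
Definition par b x : bool := \big[addb/false]_u (b u && x u).
Definition supp D x : bool := [forall v, x v ==> (v \in D)].

Lemma suppP D x : reflect (forall v, x v -> v \in D) (supp D x).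
Proof. by apply: (iffP forallP) => h v; [apply/implyP | apply/implyP/h]. Qed.

Lemma supp0 D : supp D xzero.
Proof. by apply/suppP => v; rewrite ffunE. Qed.

Lemma supp_add D x a : supp D x -> supp D a -> supp D (xadd x a).
Proof.
move=> /suppP sx /suppP sa; apply/suppP => v; rewrite ffunE.
by case: (boolP (x v)) => [/sx|_ /sa].
Qed.

Lemma suppD1_false D v x : supp (D :\ v) x -> x v = false.
Proof. by move=> /suppP s; apply/negP => /s; rewrite !inE eqxx. Qed.

Lemma xset_id v x : xset v (x v) x = x.
Proof. by apply/ffunP => u; rewrite ffunE; case: eqP => // ->. Qed.

Lemma xset_set v o o' x : xset v o (xset v o' x) = xset v o x.
Proof. by apply/ffunP => u; rewrite !ffunE; case: eqP. Qed.

Lemma xset_neg v x : xset v (~~ x v) x = xadd x (xone v).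
Proof. by apply/ffunP => u; rewrite !ffunE; case: eqP => [->|_]; rewrite (addbT, addbF). Qed.

Lemma xadd0 x : xadd x xzero = x.
Proof. by apply/ffunP => u; rewrite !ffunE addbF. Qed.

Lemma xaddA x y z : xadd x (xadd y z) = xadd (xadd x y) z.
Proof. by apply/ffunP => u; rewrite !ffunE addbA. Qed.

Lemma xaddK x y : xadd (xadd x y) y = x.
Proof. by apply/ffunP => u; rewrite !ffunE addbK. Qed.

Lemma parD b x y : par b (xadd x y) = par b x (+) par b y.
Proof.
by rewrite /par -big_split; apply: eq_bigr => u _; rewrite ffunE andb_addr.
Qed.

Lemma parDl b a x : par (xadd b a) x = par b x (+) par a x.
Proof.
by rewrite /par -big_split; apply: eq_bigr => u _; rewrite ffunE andb_addl.
Qed.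

Lemma par0l x : par xzero x = false.
Proof. by rewrite /par big1 // => u _; rewrite ffunE. Qed.

Lemma par_one b v : par b (xone v) = b v.
Proof.
rewrite /par (bigD1 v) //= big1 ?ffunE ?eqxx ?andbT ?addbF // => u uv.
by rewrite ffunE (negPf uv) andbF.
Qed.

Lemma par_onel x v : par (xone v) x = x v.
Proof. by rewrite -[RHS](par_one x); apply: eq_bigr => u _; rewrite andbC. Qed.

Lemma par_xset b v o x : x v = false -> par b (xset v o x) = par b x (+) (b v && o).
Proof.
case: o => xv; last by rewrite andbF addbF -{1}xv xset_id.
by have := xset_neg v x; rewrite xv => ->; rewrite parD par_one andbT.
Qed.

End BitStrings.

(** * Encoded states on a shrinking set of blocks *)

Section EncodedBlocks.
Variables (C : numClosedFieldType) (E : {fset nat}) (m : nat).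
Variables (L : bool -> lstate C m) (V : finType) (blk : V -> m.-tuple nat).
Hypothesis L_norm : forall o, lip (L o) (L o) = 1.
Hypothesis L_orth : lip (L false) (L true) = 0.
Hypothesis blk_uniq : forall v, uniq (blk v).
Hypothesis blk_E : forall v, all (fun q => q \in E) (blk v).
Hypothesis blk_disj : forall u v q,
  q \in (blk u : seq nat) -> q \in (blk v : seq nat) -> u = v.

Notation logical := ({ffun V -> bool} -> C).
Implicit Types (D : {set V}) (Phi : logical) (x a b : {ffun V -> bool}).

Definition covered D (S : {fset nat}) : bool :=
  all (fun q => [exists v in D, q \in (blk v : seq nat)]) (enum_fset S).

(* The blocks in [D] carry the logical state [Phi], all other qubits are in
   |0>; only the values of [Phi] on strings supported in [D] matter. *)
Definition penc D Phi : qstate C := fun S =>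
  if covered D S then
    \sum_(x : {ffun V -> bool} | supp D x)
       Phi x * \prod_(v in D) L (x v) (block_bits (blk v) S)
  else 0.

Lemma penc_eq D Phi Phi' : (forall x, supp D x -> Phi x = Phi' x) ->
  penc D Phi = penc D Phi'.
Proof.
move=> eqP; apply: funext => S; rewrite /penc; case: ifP => // _.
by apply: eq_bigr => x /eqP->.
Qed.

Lemma penc_scale D c Phi S : penc D (fun x => c * Phi x) S = c * penc D Phi S.
Proof.
rewrite /penc; case: ifP => _; last by rewrite mulr0.
by rewrite mulr_sumr; apply: eq_bigr => x _; rewrite mulrA.
Qed.

Lemma penc_sum D (Phi : bool -> logical) S :
  penc D (fun x => \sum_(o : bool) Phi o x) S = \sum_(o : bool) penc D (Phi o) S.
Proof.
rewrite /penc; case: ifP => _; last by rewrite big1.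
by rewrite exchange_big; apply: eq_bigr => x _; rewrite mulr_suml.
Qed.

Lemma coveredP D S : reflect
  (forall q, q \in S -> exists2 v, v \in D & q \in (blk v : seq nat)) (covered D S).
Proof.
apply: (iffP allP) => [h q /h /existsP[v /andP[vD qv]]|h q /h[v vD qv]].
  by exists v.
by apply/existsP; exists v; rewrite vD qv.
Qed.

Lemma penc_out D v Phi S q : v \notin D -> q \in (blk v : seq nat) -> q \in S ->
  penc D Phi S = 0.
Proof.
move=> vD qv qS; rewrite /penc; case: ifP => // /coveredP/(_ q qS)[u uD qu].
by rewrite (blk_disj qv qu) uD in vD.
Qed.

(** A string supported in [D] is a value [o] at [v] together with a string supported in [D :\ v].
    This brings one block into the shape that [local_discrimination] expects. *)
Lemma penc_split D v Phi S : v \in D ->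
  penc D Phi S = \sum_(o : bool) L o (block_bits (blk v) S) *
    penc (D :\ v) (fun x => Phi (xset v o x)) (fsetoff (blk v) S).
Proof.
move=> vD; rewrite /penc.
have -> : covered (D :\ v) (fsetoff (blk v) S) = covered D S.
  apply/coveredP/coveredP => h q.
    case: (boolP (q \in (blk v : seq nat))) => [qv _|qv qS]; first by exists v.
    by have [|u] := h q; rewrite !inE ?qS // => /andP[_ uD] qu; exists u.
  rewrite !inE => /andP[/h[u uD qu] qv]; exists u => //.
  by rewrite !inE uD andbT; apply: contraNneq qv => <-.
case: ifP => _; last by rewrite big1 // => o _; rewrite mulr0.
rewrite (partition_big (fun x => x v) predT) //=; apply: eq_bigr => o _.
rewrite mulr_sumr (reindex_onto (xset v o) (xset v false)); last first.
  by move=> x /andP[_ /eqP <-]; rewrite xset_set xset_id.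
apply: eq_big => [x|x /andP[/andP[sx _] xv]].
  rewrite xset_set ffunE !eqxx andbT.
  apply/andP/suppP => [[/suppP sx /eqP xv] u xu|sx].
    rewrite !inE; have := sx u; rewrite ffunE; case: eqP => [uv|_ -> //].
    by move: xu; rewrite -xv ffunE uv eqxx.
  split.
    apply/suppP=> u; rewrite ffunE; case: eqP => [->//|_ /sx].
    by rewrite !inE => /andP[].
  apply/eqP/ffunP=> u; rewrite ffunE; case: eqP => // ->.
  by apply/esym/negP => /sx; rewrite !inE eqxx.
rewrite mulrCA; congr (_ * _).
rewrite (bigD1 v) //= ffunE eqxx; congr (_ * _).
apply: eq_big => [u|u /andP[uD uv]]; first by rewrite !inE andbC.
rewrite ffunE (negPf uv); congr (L _ _); apply/ffunP=> j; rewrite !ffunE !inE.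
suff -> : tnth (blk u) j \notin (blk v : seq nat) by rewrite andbT.
apply: contraNN uv => h; apply/eqP; apply: blk_disj h; exact: mem_tnth.
Qed.

Definition project v (k : bool -> C) Phi : logical :=
  fun x => \sum_(o : bool) k o * Phi (xset v o x).

(** Sequences of bits suit the induction along a block, finite functions the code words; this passes
    from the former to the latter. *)
Definition bits_ffun (s : seq bool) : {ffun 'I_m -> bool} := [ffun j => nth false s (val j)].

Lemma bits_ffunE v S : bits_ffun (bits (blk v) S) = block_bits (blk v) S.
Proof.
apply/ffunP=> j; rewrite !ffunE (nth_map 0%N) ?size_tuple ?ltn_ord //.
by rewrite -tnth_nth.
Qed.

Lemma bip_lip (f g : lstate C m) :
  bip m (fun s => f (bits_ffun s)) (fun s => g (bits_ffun s)) = lip f g.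
Proof.
rewrite /bip /lip [RHS](reindex (fun t : m.-tuple bool => bits_ffun t)) //=.
exists (fun x : {ffun 'I_m -> bool} => [tuple x j | j < m]) => [t _|x _].
  by apply: eq_from_tnth => j; rewrite tnth_mktuple ffunE -tnth_nth.
by apply/ffunP=> j; rewrite ffunE -tnth_nth tnth_mktuple.
Qed.

(** [p o] is the bra of outcome [o]. Orthonormal columns resolve the identity on the block;
    orthogonal rows keep the rotated code words orthogonal. *)
Definition onbasis (p : bool -> bool -> C) : Prop :=
  (forall s t, \sum_(o : bool) (p o s)^* * p o t = (s == t)%:R) /\
  \sum_(s : bool) p false s * (p true s)^* = 0.

(** In terms of the rotated code words [u o], the block is paired with the residual state of outcome
    [o]. The [u o] are orthogonal, so discriminating them locally carries out the logical
    measurement. *)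
Lemma penc_measure v D Phi p G : v \in D -> onbasis p ->
  (forall o c, c != 0 ->
     reaches E (fun S => c * penc (D :\ v) (project v (p o) Phi) S) G) ->
  reaches E (penc D Phi) G.
Proof.
move=> vD [unit_p orth_p] reach_p.
pose u o (s : seq bool) := \sum_(t : bool) (p o t)^* * L t (bits_ffun s).
have -> : penc D Phi = (fun S => \sum_(o : bool) u o (bits (blk v) S) *
    penc (D :\ v) (project v (p o) Phi) (fsetoff (blk v) S)).
  apply: funext => S; rewrite (penc_split _ _ vD) /u /project bits_ffunE.
  under [RHS]eq_bigr do rewrite penc_sum.
  rewrite !big_bool !penc_scale /=.
  set X := block_bits _ _; set P := penc _ _ _; set Q := penc _ _ _.
  have := unit_p true true; have := unit_p true false.
  have := unit_p false true; have := unit_p false false.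
  rewrite !big_bool /= => e1 e2 e3 e4.
  transitivity (L true X * ((p true true)^* * p true true + (p false true)^* * p false true) * P
    + L true X * ((p true true)^* * p true false + (p false true)^* * p false false) * Q
    + L false X * ((p true false)^* * p true true + (p false false)^* * p false true) * P
    + L false X * ((p true false)^* * p true false + (p false false)^* * p false false) * Q).
    by rewrite e1 e2 e3 e4; ring.
  ring.
apply: (@local_discrimination C E (blk v) u (fun o => penc (D :\ v) (project v (p o) Phi)) G) => //.
- rewrite size_tuple (bip_lip (fun y => \sum_(t : bool) (p false t)^* * L t y)
     (fun y => \sum_(t : bool) (p true t)^* * L t y)).
  have L10 : lip (L true) (L false) = 0.
    rewrite -[RHS](rmorph0 Num.conj) -[in RHS]L_orth /lip rmorph_sum; apply: eq_bigr => y _.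
    by rewrite rmorphM /= conjCK mulrC.
  have [N1 N0] := (L_norm true, L_norm false).
  transitivity (p false true * (p true true)^* * lip (L true) (L true)
    + p false true * (p true false)^* * lip (L true) (L false)
    + p false false * (p true true)^* * lip (L false) (L true)
    + p false false * (p true false)^* * lip (L false) (L false)).
    rewrite /lip !mulr_sumr -!big_split; apply: eq_bigr => y _ /=.
    by rewrite !big_bool rmorphD !rmorphM /= !conjCK; ring.
  by rewrite N1 N0 L10 L_orth -[RHS]orth_p big_bool /=; ring.
- by move=> o S q qv qS; apply: (@penc_out _ v _ _ q); rewrite ?inE ?eqxx.
Qed.

(** The operator [Z^b X^a]; up to a scalar every Pauli string has this form. *)
Definition pstring a b Phi : logical := fun x => (-1) ^+ par b x * Phi (xadd x a).

(** The sign comes from moving [X^a] past [Z^b']. *)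
Lemma pstringM a b a' b' Phi x : pstring a b (pstring a' b' Phi) x =
  (-1) ^+ par b' a * pstring (xadd a a') (xadd b b') Phi x.
Proof. by rewrite /pstring parD parDl xaddA !signr_addb; ring. Qed.

Lemma pstring0 Phi : pstring (xzero V) (xzero V) Phi = Phi.
Proof. by apply: funext => x; rewrite /pstring par0l xadd0 mul1r. Qed.

(** The [X] part must stay inside [D], because [penc] reads only strings supported in [D]; a [Z]
    part outside [D] is invisible there. *)
Definition up_to_pauli D Phi (chi : qstate C) : Prop :=
  exists c a b, [/\ c != 0, supp D a & chi = fun S => c * penc D (pstring a b Phi) S].

(** Admitting every Pauli byproduct on the input is what makes conversions compose. *)
Definition converts D Phi D' Phi' : Prop :=
  forall chi, up_to_pauli D Phi chi -> reaches E chi (up_to_pauli D' Phi').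

Lemma converts_refl D Phi : converts D Phi D Phi.
Proof. by move=> chi; apply: reaches_done. Qed.

Lemma converts_trans D2 Phi2 D1 Phi1 D3 Phi3 :
  converts D1 Phi1 D2 Phi2 -> converts D2 Phi2 D3 Phi3 -> converts D1 Phi1 D3 Phi3.
Proof. by move=> h h' chi /h /reaches_bind; apply. Qed.

Lemma converts_scale D Phi Phi' c : c != 0 ->
  (forall x, supp D x -> Phi x = c * Phi' x) -> converts D Phi D Phi'.
Proof.
move=> c0 eqPhi chi [k [a [b [k0 sa ->]]]]; apply: reaches_done.
exists (k * c), a, b; split=> //; first by rewrite mulf_neq0.
apply: funext => S; rewrite -mulrA -(penc_scale D c); congr (_ * _).
suff -> : penc D (pstring a b Phi) = penc D (fun x => c * pstring a b Phi' x) by [].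
apply: penc_eq => x sx.
by rewrite /pstring eqPhi ?supp_add // mulrCA.
Qed.

(* A Pauli byproduct on the measured vertex is absorbed by a change of basis. *)
Lemma converts_measure v D Phi Phi' p : v \in D -> onbasis p ->
  (forall o, exists c a b, supp (D :\ v) a /\
     forall x, supp (D :\ v) x -> project v (p o) Phi x = c * pstring a b Phi' x) ->
  converts D Phi (D :\ v) Phi'.
Proof.
move=> vD [unit_p orth_p] hp chi [c [a [b [c0 sa ->]]]].
(* The sign cancels the [Z] part and the shift cancels the [X] part of the byproduct at [v]. *)
pose p' o s := (-1) ^+ (b v && s) * p o (s (+) a v).
have conj_sgn (z : bool) : ((-1) ^+ z : C)^* = (-1) ^+ z by rewrite rmorph_sign.
have basis_p' : onbasis p'.
  split=> [s t|]; rewrite /p'.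
    under eq_bigr do rewrite rmorphM /= conj_sgn mulrACA.
    rewrite -mulr_sumr unit_p -signr_addb.
    by case: s; case: t; case: (b v); case: (a v); rewrite /= ?mulr1 ?mulr0.
  rewrite -[RHS]orth_p !big_bool /= !rmorphM /= !conj_sgn.
  by case: (b v); case: (a v); rewrite /= ?(expr1, expr0); ring.
pose Phi1 x := c * pstring a b Phi x.
have -> : (fun S => c * penc D (pstring a b Phi) S) = penc D Phi1.
  by apply: funext => S; rewrite -penc_scale.
apply: (penc_measure vD basis_p') => o k k0.
have [co [ao [bo [sao hco]]]] := hp o.
pose a1 := xset v false a.
have sa1 : supp (D :\ v) a1.
  apply/suppP=> u; rewrite ffunE !inE; case: eqP => // _ au.
  by rewrite (suppP _ _ sa).
have eqp x : supp (D :\ v) x -> project v (p' o) Phi1 x =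
    c * co * (-1) ^+ par bo a1 * pstring (xadd a1 ao) (xadd b bo) Phi' x.
  move=> sx; have xv := suppD1_false sx.
  transitivity (c * ((-1) ^+ par b x * project v (p o) Phi (xadd x a1))).
    rewrite /project /Phi1 /pstring !mulr_sumr.
    rewrite (reindex (fun s => s (+) a v)) /=; last first.
      by exists (fun s => s (+) a v) => s _; rewrite addbK.
    apply: eq_bigr => s _; rewrite /p' addbK par_xset // signr_addb.
    have -> : xadd (xset v (s (+) a v) x) a = xset v s (xadd x a1).
      by apply/ffunP=> u; rewrite !ffunE; case: eqP => [->|//]; rewrite addbK.
    set sg := (-1) ^+ (b v && _).
    have sg2 : sg * sg = 1 by rewrite -signr_addb addbb.
    transitivity (sg * sg * (c * ((-1) ^+ par b x * (p o s * Phi (xset v s (xadd x a1)))))).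
      ring.
    by rewrite sg2 mul1r.
  rewrite hco ?supp_add // -[RHS]mulrA -pstringM /pstring; ring.
(* An outcome with [co = 0] leaves the zero vector. *)
have [co0|co0] := eqVneq co 0.
  left; apply: funext => S; rewrite (penc_eq (Phi' := fun x => 0 * Phi x)).
    by rewrite penc_scale mul0r mulr0.
  by move=> x /eqp->; rewrite co0 mulr0 !mul0r.
apply: reaches_done.
exists (k * (c * co * (-1) ^+ par bo a1)), (xadd a1 ao), (xadd b bo); split.
- by rewrite !mulf_neq0 // signr_eq0.
- exact: supp_add.
apply: funext => S; rewrite -mulrA; congr (_ * _).
by rewrite -penc_scale; congr (_ S); apply: penc_eq.
Qed.

(** * Measurement patterns on graph states *)

Section GraphState.
Variables (adj : rel V) (g : logical).
Definition nbr v : {ffun V -> bool} := [ffun u => adj v u].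
Hypothesis g_stab : forall v x, g (xadd x (xone v)) = (-1) ^+ par (nbr v) x * g x.

Variable n : nat.
Implicit Types (io : 'I_n -> V) (phi : lstate C n).

Definition pull io x : {ffun 'I_n -> bool} := [ffun k => x (io k)].

(* The [n]-qubit state [phi] sits on the vertices [io k], all the other
   vertices are in |+>, and a controlled-Z acts along every edge. *)
Definition wires io phi : logical := fun x => phi (pull io x) * g x.

Lemma g_xset v s x : x v = false ->
  g (xset v s x) = (-1) ^+ (s && par (nbr v) x) * g x.
Proof.
case: s => xv /=; last by rewrite mul1r -{1}xv xset_id.
by have := xset_neg v x; rewrite xv => ->; rewrite g_stab.
Qed.

(** Deleted vertices carry the bit 0, so a neighbourhood may be computed among the surviving
    vertices only. *)
Lemma par_nbr v D (S x : {ffun V -> bool}) : (forall z, z \in D -> adj v z = S z) ->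
  supp D x -> par (nbr v) x = par S x.
Proof.
move=> h /suppP sx; apply: eq_bigr => z _; rewrite ffunE.
by case: (boolP (x z)) => [/sx/h->|]; rewrite ?andbF.
Qed.

(** For [w = exp (i theta)], [p0] is [cos theta] and [p1] is [i sin theta]. Summing over the bit at
    [v] gives [p0 + p1 = w] or [p0 - p1 = w^*] according to the parity of the neighbours. The other
    outcome swaps [p0] and [p1], which amounts to a [Z] on each neighbour. *)
Lemma converts_phase v D io phi phi' w : v \in D -> (forall k, io k != v) ->
  w * w^* = 1 ->
  (forall x, supp (D :\ v) x -> phi' (pull io x) =
     (if par (nbr v) x then w^* else w) * phi (pull io x)) ->
  converts D (wires io phi) (D :\ v) (wires io phi').
Proof.
move=> vD iov ww hphi.
pose p0 := (w + w^*) / 2; pose p1 := (w - w^*) / 2.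
have p0c : p0^* = p0 by rewrite /p0 rmorphM fmorphV rmorphD rmorph_nat /= conjCK addrC.
have p1c : p1^* = - p1.
  by rewrite /p1 rmorphM fmorphV rmorphB rmorph_nat /= conjCK -mulNr opprB.
have p01 : p0 * p0 - p1 * p1 = 1 by rewrite -ww /p0 /p1; field.
have pw : p0 + p1 = w by rewrite /p0 /p1; field.
have pwc : p0 - p1 = w^* by rewrite /p0 /p1; field.
apply: (@converts_measure v D _ _ (fun o s => if o == s then p0 else p1)) => //.
  split=> [[] []|]; rewrite big_bool /= ?p0c ?p1c -?p01 /=; ring.
move=> o; exists 1, (xzero V), (if o then nbr v else xzero V).
split=> [|x sx]; first exact: supp0.
have pl s : pull io (xset v s x) = pull io x.
  by apply/ffunP=> k; rewrite !ffunE (negPf (iov k)).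
have xv := suppD1_false sx.
rewrite /project big_bool /wires /pstring !pl !g_xset // xadd0 hphi //= mul1r.
rewrite -pwc -pw; case: o; rewrite ?par0l /=; case: (par _ x) => /=;
  rewrite ?expr1 ?expr0; ring.
Qed.

Lemma converts_delete D D' io phi : D' \subset D -> (forall k, io k \in D') ->
  converts D (wires io phi) D' (wires io phi).
Proof.
move=> + ioD'; move: {2}#|_| (leqnn #|D :\: D'|) => N.
elim: N D => [|N IH] D.
  rewrite leqn0 cards_eq0 setD_eq0 => DD' D'D.
  by have -> : D = D' by [apply/eqP; rewrite eqEsubset DD']; apply: converts_refl.
move=> cN D'D; have [D0|[v]] := set_0Vmem (D :\: D').
  have -> : D = D' by apply/eqP; rewrite eqEsubset D'D -setD_eq0 D0 eqxx.
  exact: converts_refl.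
move=> vDD; have := vDD; rewrite inE => /andP[vD' vD].
apply: (@converts_trans (D :\ v) (wires io phi)).
  (* With [w = 1] this is a measurement in the computational basis. *)
  apply: (@converts_phase _ _ _ _ _ 1) => //; rewrite ?rmorph1 ?mulr1 //.
    by move=> k; apply: contraNneq vD' => <-.
  by move=> x _; case: ifP; rewrite mul1r.
apply: IH.
  by move: cN; rewrite (cardsD1 v) vDD setDDl setUC -setDDl.
by rewrite subsetD1 D'D.
Qed.

(** One-bit teleportation: [u] is the only surviving neighbour of [v] and carries no input, so
    summing over the bit at [v] places [H diag(1, w)] of the input on [u]. *)
Lemma converts_wire k u v D io io' phi w :
  io k = v -> io' k = u -> (forall j, j != k -> io' j = io j) ->
  v \in D -> u \in D :\ v -> (forall j, j != k -> io j != v) -> (forall j, io j != u) ->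
  w * w^* = 1 -> (forall x, supp (D :\ v) x -> par (nbr v) x = x u) ->
  converts D (wires io phi) (D :\ v) (wires io'
    (fun y => phi (xset k false y) + (-1) ^+ y k * w * phi (xset k true y))).
Proof.
move=> iok io'k io'j vD uD ioj iou ww parv; set phi' := fun y => _.
pose r : C := sqrtC 2^-1.
have r0 : 0 <= r by rewrite sqrtC_ge0 invr_ge0 ler0n.
have rc : r^* = r by apply/CrealP/ger0_real.
have r2 : r * r = 2^-1 by rewrite -expr2 sqrtCK.
have wwc : w^* * w = 1 by rewrite mulrC.
apply: (@converts_measure v D _ _
  (fun o s => r * (if s then (-1) ^+ (o : bool) * w else 1))) => //.
  split=> [s t|]; last first.
    rewrite big_bool /= !rmorphM /= rmorph1 rmorphN1 rc.
    transitivity (r * r * (1 - w * w^*)); first by ring.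
    by rewrite ww subrr mulr0.
  transitivity (r * r * \sum_(o : bool) ((if s then (-1) ^+ o * w^* else 1) *
      (if t then (-1) ^+ o * w else 1))).
    rewrite mulr_sumr; apply: eq_bigr => o _; rewrite rmorphM /= rc.
    by case: s; rewrite ?rmorph1 ?rmorphM ?rmorph_sign /=; case: t; ring.
  rewrite r2 big_bool; case: s; case: t; rewrite /= ?expr1 ?expr0 ?mul1r ?mulr1.
  - transitivity (2^-1 * 2 * (w^* * w)); first by ring.
    by rewrite wwc mulr1 mulVf ?pnatr_eq0.
  - by rewrite mulN1r addNr mulr0.
  - by rewrite mulN1r addNr mulr0.
  - by field.
have uv : u != v by move: uD; rewrite !inE => /andP[].
(* Outcome [true] flips the output bit. An [X] at [u] also acts on [g], and by the stabilizer
   equation the [Z] string on the neighbours of [u] undoes this. *)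
move=> o; exists r, (if o then xone u else xzero V), (if o then nbr u else xzero V).
split=> [|x sx].
  case: o; last exact: supp0.
  by apply/suppP=> z; rewrite ffunE => /eqP->.
have xv := suppD1_false sx.
have pl s : pull io (xset v s x) = xset k s (pull io' x).
  apply/ffunP=> j; rewrite !ffunE; have [->|jk] := eqVneq j k; first by rewrite iok eqxx.
  by rewrite (negPf (ioj j jk)) io'j.
have yk : pull io' x k = x u by rewrite ffunE io'k.
rewrite /project big_bool /wires !pl !g_xset //= parv //.
case: o => /=; last first.
  by rewrite pstring0 /phi' yk; case: (x u) => /=; rewrite ?expr1 ?expr0; ring.
rewrite /pstring g_stab.
have -> : pull io' (xadd x (xone u)) = xset k (~~ x u) (pull io' x).
  apply/ffunP=> j; rewrite !ffunE; have [->|jk] := eqVneq j k.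
    by rewrite io'k eqxx addbT.
  by rewrite io'j // (negPf (iou j)) addbF.
rewrite /phi' !xset_set ffunE eqxx mulrCA mulrA.
set sg := (-1) ^+ par _ _.
have sg2 : sg * sg = 1 by rewrite -signr_addb addbb.
transitivity (sg * sg * (r * (phi (xset k false (pull io' x)) +
   (-1) ^+ (~~ x u) * w * phi (xset k true (pull io' x))) * g x)); last by ring.
by rewrite sg2; case: (x u) => /=; rewrite ?expr1 ?expr0; ring.
Qed.

(** Without edges inside [D] each bit flips at no cost in sign. On the output vertices the graph
    amplitude is therefore a mere scalar. *)
Lemma g_independent D x : (forall u v, u \in D -> v \in D -> adj u v = false) ->
  supp D x -> g x = g (xzero V).
Proof.
move=> indep; move: {2}#|_| (leqnn #|[set v | x v]|) => N.
elim: N x => [|N IH] x.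
  rewrite leqn0 cards_eq0 => /eqP/setP x0 _; congr g; apply/ffunP=> v.
  by have := x0 v; rewrite !inE ffunE.
move=> cN sx; have [x0|[v]] := set_0Vmem [set v | x v].
  congr g; apply/ffunP=> v.
  by have /setP/(_ v) := x0; rewrite !inE ffunE.
rewrite inE => xv; have vD := suppP _ _ sx v xv.
have sx' : supp D (xadd x (xone v)).
  by apply: supp_add => //; apply/suppP => u; rewrite ffunE => /eqP->.
rewrite -[x](xaddK x (xone v)) g_stab.
have -> : par (nbr v) (xadd x (xone v)) = false.
  rewrite /par big1 // => u _; rewrite ffunE.
  case: (boolP (xadd x (xone v) u)) => [xu|]; last by rewrite andbF.
  by rewrite indep //; apply: (suppP _ _ sx').
rewrite mul1r; apply: IH => //.
move: cN; rewrite (cardsD1 v) inE xv ltnS.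
suff -> : [set v | x v] :\ v = [set u | xadd x (xone v) u] by [].
apply/setP=> u; rewrite !inE !ffunE; case: eqP => [->|_] /=; first by rewrite xv.
by rewrite addbF.
Qed.

End GraphState.
End EncodedBlocks.

(** * Exact synthesis of states *)

Section Circuits.
Variables (C : numClosedFieldType) (n : nat).
Notation state := (lstate C n).
Notation string := {ffun 'I_n -> bool}.
Implicit Types (phi psi : state) (x y S : string) (k l : 'I_n) (w : C) (u : string -> C).

(** This is [exp (i theta Z_S)] for [w = exp (i theta)]. *)
Definition phase S w phi : state := fun x => (if par S x then w^* else w) * phi x.
(** Twice [H diag(1, w) H] on qubit [k]. *)
Definition xrot k w phi : state :=
  fun x => (1 + w) * phi x + (1 - w) * phi (xadd x (xone k)).

(* The index counts the pairs of columns of the cluster that the circuit uses. *)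
Inductive circ : nat -> state -> state -> Prop :=
| circ_scale c phi : c != 0 -> circ 0 phi (fun x => c * phi x)
| circ_z k w phi : w * w^* = 1 -> circ 1 phi (phase (xone k) w phi)
| circ_zz k l w phi : l = k.+1 :> nat -> w * w^* = 1 ->
    circ 1 phi (phase (xadd (xone k) (xone l)) w phi)
| circ_x k w phi : w * w^* = 1 -> circ 1 phi (xrot k w phi)
| circ_trans d1 d2 phi psi chi :
    circ d1 phi psi -> circ d2 psi chi -> circ (d1 + d2) phi chi.

Definition circuit phi psi := exists d, circ d phi psi.

Lemma circuit_trans phi psi chi : circuit phi psi -> circuit psi chi -> circuit phi chi.
Proof. by move=> [d1 h1] [d2 h2]; exists (d1 + d2)%N; apply: circ_trans h1 h2. Qed.

Lemma circuit_scale c phi psi : c != 0 -> (forall x, phi x = c * psi x) -> circuit phi psi.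
Proof.
move=> c0 h; exists 0%N.
have -> : psi = (fun x => c^-1 * phi x) by apply: funext => x; rewrite h mulKf.
by apply: circ_scale; rewrite invr_eq0.
Qed.

Lemma unit_neq0 w : w * w^* = 1 -> w != 0.
Proof.
by move=> ww; apply: contra_eq_neq ww => ->; rewrite mul0r eq_sym oner_eq0.
Qed.

Lemma unit_conj w : w * w^* = 1 -> w^* * w^*^* = 1.
Proof. by rewrite conjCK mulrC. Qed.

Lemma unit_normP w : (w * w^* = 1) <-> (`|w| = 1).
Proof.
rewrite -normCK; split=> [/eqP|->]; last by rewrite expr1n.
by rewrite sqrp_eq1 ?normr_ge0 // => /eqP.
Qed.

Lemma unit_sqrtC w : w * w^* = 1 -> sqrtC w * (sqrtC w)^* = 1.
Proof.
move=> /unit_normP w1; apply/unit_normP/eqP.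
by rewrite -sqrp_eq1 ?normr_ge0 // -normrX sqrtCK w1.
Qed.

Lemma unit_mul w w' : w * w^* = 1 -> w' * w'^* = 1 -> (w * w') * (w * w')^* = 1.
Proof. by move=> h h'; rewrite rmorphM mulrACA h h' mulr1. Qed.

(** Each rotation is undone by the one with [w^*], which costs the same number of columns; [xrot] is
    twice a unitary, whence the factor 4. *)
Lemma circuit_sym phi psi : circuit phi psi -> circuit psi phi.
Proof.
move=> [d]; elim=> {d phi psi} [c phi c0|k w phi ww|k l w phi kl ww|k w phi ww|].
- exact: (@circuit_scale c).
- exists 1%N; have {2}-> : phi = phase (xone k) w^* (phase (xone k) w phi).
    apply: funext => x; rewrite /phase conjCK mulrA.
    by case: ifP; rewrite ?ww ?[w^* * w]mulrC ?ww mul1r.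
  by apply: circ_z; apply: unit_conj.
- exists 1%N; set S := xadd _ _; have {2}-> : phi = phase S w^* (phase S w phi).
    apply: funext => x; rewrite /phase conjCK mulrA.
    by case: ifP; rewrite ?ww ?[w^* * w]mulrC ?ww mul1r.
  by apply: circ_zz => //; apply: unit_conj.
- apply: (@circuit_trans _ (xrot k w^* (xrot k w phi))).
    by exists 1%N; apply: circ_x; apply: unit_conj.
  apply: (@circuit_scale 4); first by rewrite pnatr_eq0.
  move=> x; rewrite /xrot xaddK.
  transitivity (2 * (1 + w * w^*) * phi x + 2 * (1 - w * w^*) * phi (xadd x (xone k))).
    ring.
  by rewrite ww; ring.
- by move=> d1 d2 phi psi chi _ h1 _ h2; apply: circuit_trans h2 h1.
Qed.

Lemma circuit_zero phi psi : circuit phi psi -> (forall x, phi x = 0) ->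
  forall x, psi x = 0.
Proof.
move=> [d]; elim=> {d phi psi} [c phi c0|k w phi ww|k l w phi kl ww|k w phi ww|].
- by move=> h x; rewrite h mulr0.
- by move=> h x; rewrite /phase h mulr0.
- by move=> h x; rewrite /phase h mulr0.
- by move=> h x; rewrite /xrot !h !mulr0 addr0.
- by move=> d1 d2 phi psi chi _ h1 _ h2 h; apply/h2/h1.
Qed.

Definition implementable (U : state -> state) := forall phi, circuit phi (U phi).

Lemma implementable_scale c U U' : c != 0 -> (forall phi x, U phi x = c * U' phi x) ->
  implementable U -> implementable U'.
Proof.
by move=> c0 h iU phi; apply: circuit_trans (iU phi) _; apply: (circuit_scale c0).
Qed.

Lemma implementable_comp U U' : implementable U -> implementable U' ->
  implementable (fun phi => U' (U phi)).
Proof. by move=> h h' phi; apply: circuit_trans (h phi) (h' _). Qed.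

Definition had k phi : state :=
  fun x => phi (xset k false x) + (-1) ^+ x k * phi (xset k true x).

(** Euler decomposition: for [w^2 = - i], [phase (xone k) w] is [S = diag(1, i)] up to a scalar,
    [xrot k i] is twice [H S H], and [S (H S H) S] is proportional to [H]. *)
Lemma implementable_had k : implementable (had k).
Proof.
have ii : 'i * 'i = -1 :> C by rewrite -expr2 sqrCi.
pose w : C := sqrtC (- 'i).
have ww : w * w^* = 1.
  by apply: unit_sqrtC; rewrite rmorphN /= conjCi opprK mulNr ii opprK.
have w2 : w * w = - 'i by rewrite -expr2 sqrtCK.
have w2c : w^* * w^* = 'i by rewrite -rmorphM w2 rmorphN /= conjCi opprK.
clearbody w.
have iw : implementable (phase (xone k) w) by move=> phi; exists 1%N; apply: circ_z.
have ix : implementable (xrot k 'i).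
  by move=> phi; exists 1%N; apply: circ_x; rewrite conjCi mulrN ii opprK.
apply: (implementable_scale (c := 1 - 'i)) (implementable_comp (implementable_comp iw ix) iw).
  apply/eqP => /eqP; rewrite subr_eq0 => /eqP i1; move: ii.
  by rewrite -i1 mulr1 => /eqP; rewrite -addr_eq0 -mulr2n pnatr_eq0.
move=> phi x; rewrite /phase /xrot /had !par_onel !ffunE eqxx addbT.
case xk: (x k) => /=.
  have -> : xset k true x = x by rewrite -{1}xk xset_id.
  have <- : xset k false x = xadd x (xone k) by rewrite -xset_neg xk.
  transitivity ((1 + 'i) * (w^* * w^*) * phi x + (1 - 'i) * (w * w^*) * phi (xset k false x)).
    ring.
  rewrite w2c ww; transitivity (('i + 'i * 'i) * phi x + (1 - 'i) * phi (xset k false x)).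
    ring.
  by rewrite ii; ring.
have -> : xset k false x = x by rewrite -{1}xk xset_id.
have <- : xset k true x = xadd x (xone k) by rewrite -xset_neg xk.
transitivity ((1 + 'i) * (w * w) * phi x + (1 - 'i) * (w * w^*) * phi (xset k true x)).
  ring.
rewrite w2 ww; transitivity ((- 'i - 'i * 'i) * phi x + (1 - 'i) * phi (xset k true x)).
  ring.
by rewrite ii; ring.
Qed.

Definition diag u phi : state := fun x => u x * phi x.

Lemma implementable_diagM u u' : implementable (diag u) -> implementable (diag u') ->
  implementable (diag (fun x => u x * u' x)).
Proof.
move=> h h'; apply: (implementable_scale (c := 1)) (implementable_comp h h').
  exact: oner_neq0.
by move=> phi x; rewrite /diag; ring.
Qed.

(** Product of the rotations about [Z_k], [Z_l] and, with opposite angle, [Z_k Z_l]. With [w^4 = -1]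
    the diagonal entries are [w], [w], [w] and [w^-3 = - w]. *)
Lemma implementable_cz k l : l = k.+1 :> nat ->
  implementable (diag (fun x => (-1) ^+ (x k && x l))).
Proof.
move=> kl.
have kl' : k != l by rewrite -val_eqE /= kl neq_ltn ltnSn.
have ii : 'i * 'i = -1 :> C by rewrite -expr2 sqrCi.
pose w : C := sqrtC 'i.
have ww : w * w^* = 1 by apply: unit_sqrtC; rewrite conjCi mulrN ii opprK.
have w4 : w * w * (w * w) = -1 by rewrite -!expr2 sqrtCK sqrCi.
clearbody w.
have w0 := unit_neq0 ww.
have wV : w^* = w^-1 by rewrite -[LHS](mulKf w0) ww mulr1.
have h1 : implementable (diag (fun x => if par (xone k) x then w^* else w)).
  by move=> phi; exists 1%N; apply: circ_z.
have h2 : implementable (diag (fun x => if par (xone l) x then w^* else w)).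
  by move=> phi; exists 1%N; apply: circ_z.
have h3 : implementable (diag (fun x => if par (xadd (xone k) (xone l)) x then w^*^* else w^*)).
  by move=> phi; exists 1%N; apply: circ_zz => //; apply: unit_conj.
apply: (implementable_scale (c := w)) (implementable_diagM (implementable_diagM h1 h2) h3) => //.
move=> phi x; rewrite /diag parDl !par_onel mulrA; congr (_ * _).
rewrite conjCK wV.
case: (x k); case: (x l) => /=; rewrite ?expr1 ?expr0; [|by field..].
have -> : w^-1 * w^-1 * w^-1 = w / (w * w * (w * w)) by field.
by rewrite w4 invrN1.
Qed.

Definition adjacent k l := (l == k.+1 :> nat) || (k == l.+1 :> nat).

Definition cnot k l phi : state := fun x => phi (xset l (x l (+) x k) x).

Lemma implementable_cnot k l : adjacent k l -> implementable (cnot k l).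
Proof.
move=> kl.
have lk : k == l = false by rewrite -val_eqE /=; move: kl; rewrite /adjacent; lia.
have cz : implementable (diag (fun x => (-1) ^+ (x k && x l))).
  case/orP: kl => /eqP kl; first exact: implementable_cz.
  apply: (implementable_scale (c := 1)) (implementable_cz kl); first exact: oner_neq0.
  by move=> phi x; rewrite mul1r /diag andbC.
have h := implementable_had l.
apply: (implementable_scale (c := 2)) (implementable_comp (implementable_comp h cz) h).
  by rewrite pnatr_eq0.
move=> phi x; rewrite /had /diag /cnot !ffunE !eqxx lk !xset_set.
by case: (x k); case: (x l) => /=; rewrite ?expr1 ?expr0; ring.
Qed.

Definition phase_ok S := forall w, w * w^* = 1 -> implementable (phase S w).

Lemma phase_ok_one k : phase_ok (xone k).
Proof. by move=> w ww phi; exists 1%N; apply: circ_z. Qed.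

(** Conjugation by the CNOT with control [k] and target [l] turns [Z_l] into [Z_k Z_l]. *)
Lemma phase_ok_toggle k l S : adjacent k l -> S l -> phase_ok S ->
  phase_ok (xadd S (xone k)).
Proof.
move=> kl Sl hS w ww.
have lk : k == l = false by rewrite -val_eqE /=; move: kl; rewrite /adjacent; lia.
have hc := implementable_cnot kl.
apply: (implementable_scale (c := 1)) (implementable_comp (implementable_comp hc (hS w ww)) hc).
  exact: oner_neq0.
move=> phi x; rewrite mul1r /phase /cnot parDl par_onel !ffunE !eqxx lk xset_set.
rewrite addbK xset_id.
suff -> : par S (xset l (x l (+) x k) x) = par S x (+) x k by [].
case xk: (x k); last by rewrite !addbF xset_id.
by rewrite !addbT xset_neg parD par_one Sl addbT.
Qed.

(** CNOTs between neighbours suffice: from the largest element [M] of [S] the set is grown down to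
    the whole interval [[0, M]], and then the elements not in [S] are removed from the bottom
    upwards. *)
Lemma phase_ok_all S : phase_ok S.
Proof.
have [->|S0] := eqVneq S (xzero _).
  move=> w ww phi; apply: (@circuit_scale w^*).
    by rewrite conjC_eq0 unit_neq0.
  by move=> x; rewrite /phase par0l mulrA [w^* * w]mulrC ww mul1r.
have [i0 Si0] : exists i, S i.
  apply/existsP; apply: contraNT S0; rewrite negb_exists => /forallP S0.
  by apply/eqP/ffunP=> i; have /negPf-> := S0 i; rewrite ffunE.
case: (@arg_maxnP _ i0 [pred i | S i] (fun i => val i) Si0) => M /= SM Smax {i0 Si0}.
have grow e : (e <= M)%N -> phase_ok [ffun i : 'I_n => (M - e <= i <= M)%N].
  elim: e => [_|e IH eM].
    rewrite (_ : [ffun _ => _] = xone M); first exact: phase_ok_one.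
    by apply/ffunP=> i; rewrite !ffunE -val_eqE /= subn0; lia.
  have jn : (M - e.+1 < n)%N by have := ltn_ord M; lia.
  have j1n : (M - e < n)%N by have := ltn_ord M; lia.
  have h : adjacent (Ordinal jn) (Ordinal j1n) by rewrite /adjacent /=; lia.
  rewrite (_ : [ffun _ => _] =
     xadd [ffun i : 'I_n => (M - e <= i <= M)%N] (xone (Ordinal jn))).
    by apply: (phase_ok_toggle h); rewrite ?ffunE /=; [lia | apply: IH; lia].
  by apply/ffunP=> i; rewrite !ffunE -val_eqE /=; lia.
(* When [j] is removed, [j + 1] is still in the set and can serve as the target. *)
have shrink j : (j <= M)%N -> phase_ok [ffun i : 'I_n => (i <= M)%N && ((j <= i)%N || S i)].
  elim: j => [_|j IH jM].
    rewrite (_ : [ffun _ => _] = [ffun i : 'I_n => (M - M <= i <= M)%N]); first exact: grow.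
    by apply/ffunP=> i; rewrite !ffunE subnn andbT.
  have jn : (j < n)%N by have := ltn_ord M; lia.
  have j1n : (j.+1 < n)%N by have := ltn_ord M; lia.
  have h : adjacent (Ordinal jn) (Ordinal j1n) by rewrite /adjacent /=; lia.
  have {}IH := IH (ltnW jM).
  case Sj : (S (Ordinal jn)).
    rewrite (_ : [ffun _ => _] = [ffun i : 'I_n => (i <= M)%N && ((j <= i)%N || S i)]) //.
    apply/ffunP=> i; rewrite !ffunE; have [->|ij] := eqVneq i (Ordinal jn).
      by rewrite Sj !orbT.
    by move: ij; rewrite -val_eqE /=; case: (S i); lia.
  rewrite (_ : [ffun _ => _] =
    xadd [ffun i : 'I_n => (i <= M)%N && ((j <= i)%N || S i)] (xone (Ordinal jn))).
    by apply: (phase_ok_toggle h) => //; rewrite ffunE /=; lia.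
  apply/ffunP=> i; rewrite !ffunE; have [->|ij] := eqVneq i (Ordinal jn).
    by rewrite Sj /= ltnn leqnn (ltnW jM).
  by move: ij; rewrite -val_eqE /=; case: (S i); lia.
have := shrink M (leqnn M); rewrite (_ : [ffun _ => _] = S) //.
apply/ffunP=> i; rewrite !ffunE; case Si: (S i).
  by have := Smax i Si; rewrite orbT andbT.
rewrite orbF; apply/negbTE/negP => iM.
have eiM : i = M by apply/val_inj => /=; lia.
by rewrite -eiM Si in SM.
Qed.

(* Splitting [u] along the bit [i] as [f * h^(+-1)] with [f^2 = u0 u1], where the
   exponent is [-1] on [x i = true], trades one bit for one more element of [S]. *)
Lemma implementable_diag_on (s : seq 'I_n) u S :
  (forall x, u x * (u x)^* = 1) ->
  (forall x y, {in s, x =1 y} -> u x = u y) ->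
  implementable (diag (fun x => if par S x then (u x)^* else u x)).
Proof.
elim: s u S => [|i s IH] u S uu dep.
  have := phase_ok_all S (uu (xzero _)).
  apply: (implementable_scale (c := 1)); first exact: oner_neq0.
  by move=> phi x; rewrite mul1r /phase /diag (dep x (xzero _)).
pose u0 x := u (xset i false x); pose u1 x := u (xset i true x).
pose f x := sqrtC (u0 x * u1 x); pose h x := u0 x * (f x)^*.
have ff x : f x * (f x)^* = 1 by apply: unit_sqrtC; apply: unit_mul; apply: uu.
have hh x : h x * (h x)^* = 1 by apply: unit_mul; [apply: uu | apply: unit_conj; apply: ff].
have dep' o x y : {in s, x =1 y} -> u (xset i o x) = u (xset i o y).
  move=> xy; apply: dep => j; rewrite inE !ffunE; case: eqP => //= _; exact: xy.
have f_dep x y : {in s, x =1 y} -> f x = f y by move=> xy; rewrite /f /u0 /u1 !(dep' _ x y).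
have h_dep x y : {in s, x =1 y} -> h x = h y.
  by move=> xy; rewrite /h /u0 (f_dep x y) // (dep' _ x y).
have H := implementable_diagM (IH f S ff f_dep) (IH h (xadd S (xone i)) hh h_dep).
apply: (implementable_scale (c := 1)) H; first exact: oner_neq0.
have fh0 x : f x * h x = u0 x.
  by rewrite /h mulrCA ff mulr1.
have fh1 x : f x * (h x)^* = u1 x.
  rewrite /h rmorphM /= conjCK mulrCA -expr2 sqrtCK mulrA [_^* * _]mulrC uu mul1r //.
move=> phi x; rewrite mul1r /diag parDl par_onel; congr (_ * _).
have ux : u x = if x i then u1 x else u0 x.
  by rewrite /u0 /u1; case xi: (x i); rewrite -{1}xi xset_id.
rewrite ux -fh0 -fh1.
by case: (par S x); case: (x i) => /=; rewrite ?rmorphM /= ?conjCK.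
Qed.

Lemma implementable_diag u : (forall x, u x * (u x)^* = 1) -> implementable (diag u).
Proof.
move=> uu; apply: (implementable_scale (c := 1) _ _
  (@implementable_diag_on (enum 'I_n) u (xzero _) uu _)); first exact: oner_neq0.
  by move=> phi x; rewrite mul1r /diag par0l.
by move=> x y xy; congr u; apply/ffunP=> i; apply: xy; rewrite mem_enum.
Qed.

Lemma align_phase (z z' : C) : z * z^* = z' * z'^* -> exists t, t * t^* = 1 /\ t * z' = z.
Proof.
have [->|z0] := eqVneq z' 0.
  rewrite mul0r => /eqP; rewrite mulf_eq0 conjC_eq0 orbb => /eqP->.
  by exists 1; split; rewrite ?rmorph1 ?mulr0 ?mulr1.
move=> h; exists (z / z'); split; last by rewrite divfK.
by rewrite rmorphM fmorphV /= mulrACA h -invfM divff // mulf_neq0 // conjC_eq0.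
Qed.

(** The two moduli agree exactly when [a * (v * b)^*] is purely imaginary, so [v] puts [v * b] in
    quadrature with [a]. *)
Lemma quadrature_phase (a b : C) : exists v, v * v^* = 1 /\
  (a + v * b) * (a + v * b)^* = (a - v * b) * (a - v * b)^*.
Proof.
have ii : 'i * 'i = -1 :> C by rewrite -expr2 sqrCi.
pose z := a * b^*.
suff [v [vv hv]] : exists v, v * v^* = 1 /\ z * v^* + z^* * v = 0.
  exists v; split=> //; apply/eqP; rewrite -subr_eq0; apply/eqP.
  transitivity (2 * (z * v^* + z^* * v)); last by rewrite hv mulr0.
  by rewrite /z rmorphB rmorphD !rmorphM /= conjCK; ring.
clearbody z; have [->|z0] := eqVneq z 0.
  by exists 1; rewrite rmorph1 rmorph0 !mul0r addr0 mulr1.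
have nz : `|z| != 0 by rewrite normr_eq0.
exists ('i * (z / `|z|)).
have -> : ('i * (z / `|z|))^* = - ('i * (z^* / `|z|)).
  by rewrite !rmorphM fmorphV /= conjCi conj_normC mulNr.
split; last by field.
transitivity (- ('i * 'i) * (z * z^*) / `|z| ^+ 2); first by field.
by rewrite ii opprK mul1r -normCK divff // expf_neq0.
Qed.

(** The first diagonal gives the two amplitudes equal modulus after [H_k]; the second aligns their
    phases, so that the next [H_k] cancels the one with bit [k] set. Only strings differing at [k]
    are mixed, so the bits in [s] stay clear. *)
Lemma circuit_clear_bit k (s : seq 'I_n) phi :
  (forall x i, i \in s -> x i -> phi x = 0) ->
  exists2 psi, circuit phi psi & forall x i, i \in k :: s -> x i -> psi x = 0.
Proof.
move=> phi0.
have [vf vfP] := choice (fun p : C * C => quadrature_phase p.1 p.2).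
pose a x := phi (xset k false x); pose b x := phi (xset k true x).
pose v x := vf (a x, b x).
pose lo x := a x + v x * b x; pose hi x := a x - v x * b x.
have lohi x : lo x * (lo x)^* = hi x * (hi x)^* by have [_] := vfP (a x, b x).
(* [align_phase] has a premise, so the choice function takes pairs bundled with a proof of equal
   modulus. *)
have [tf tfP] := choice (fun p : {p : C * C | p.1 * p.1^* = p.2 * p.2^*} =>
  align_phase (proj2_sig p)).
pose t x := tf (exist _ (lo x, hi x) (lohi x)).
have tt x : t x * (t x)^* = 1 /\ t x * hi x = lo x by apply: (tfP (exist _ (lo x, hi x) (lohi x))).
pose u1 x := if x k then v x else 1; pose u2 x := if x k then t x else 1.
have u1u x : u1 x * (u1 x)^* = 1.
  by rewrite /u1; case: ifP => _; [case: (vfP (a x, b x)) | rewrite rmorph1 mulr1].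
have u2u x : u2 x * (u2 x)^* = 1.
  by rewrite /u2; case: ifP => _; [case: (tt x) | rewrite rmorph1 mulr1].
exists (had k (diag u2 (had k (diag u1 phi)))).
  apply: circuit_trans (implementable_had k _).
  apply: circuit_trans (implementable_diag u2u _).
  apply: circuit_trans (implementable_had k _).
  exact: implementable_diag.
move=> x i ik xi.
have aE o : a (xset k o x) = a x by rewrite /a xset_set.
have bE o : b (xset k o x) = b x by rewrite /b xset_set.
have vE o : v (xset k o x) = v x by rewrite /v aE bE.
have loE o : lo (xset k o x) = lo x by rewrite /lo aE bE vE.
have hiE o : hi (xset k o x) = hi x by rewrite /hi aE bE vE.
have had1 o : had k (diag u1 phi) (xset k o x) = if o then hi x else lo x.
  rewrite /had /diag /u1 !xset_set !ffunE !eqxx vE mul1r -/(a x) -/(b x) /hi /lo.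
  by case: o; rewrite ?expr1 ?expr0 ?mul1r ?mulN1r.
rewrite /had in had1 *; rewrite /diag in had1 *.
rewrite /u2 !had1 !ffunE !eqxx mul1r.
have [ki|ki] := eqVneq i k.
  have [_ th] := tt (xset k true x); rewrite hiE loE in th.
  by rewrite -ki xi ki th expr1 mulN1r subrr.
have {}ik : i \in s by move: ik; rewrite inE (negPf ki).
have ab0 : a x = 0 /\ b x = 0.
  by split; apply: (phi0 _ i) => //; rewrite ffunE (negPf ki).
by rewrite /lo /hi !(proj1 ab0, proj2 ab0) !(mulr0, addr0, subr0).
Qed.

Lemma circuit_to_zero phi : exists c : C, circuit phi (fun x => c * (x == xzero _)%:R).
Proof.
suff [psi hpsi psi0] : exists2 psi, circuit phi psi &
    forall x i, i \in enum 'I_n -> x i -> psi x = 0.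
  exists (psi (xzero _)); apply: circuit_trans hpsi _.
  apply: (@circuit_scale 1) => [|x]; first exact: oner_neq0.
  rewrite mul1r; have [->|x0] := eqVneq x (xzero _); first by rewrite mulr1.
  rewrite mulr0; have [i xi] : exists i, x i.
    apply/existsP; apply: contraNT x0; rewrite negb_exists => /forallP x0.
    by apply/eqP/ffunP=> i; have /negPf-> := x0 i; rewrite ffunE.
  by apply: (psi0 x i) => //; rewrite mem_enum.
elim: (enum 'I_n) => [|k s [psi hpsi psi0]].
  by exists phi => //; apply: (@circuit_scale 1) => [|x]; rewrite ?oner_neq0 ?mul1r.
have [psi' h h0] := circuit_clear_bit k psi0.
by exists psi' => //; apply: circuit_trans hpsi h.
Qed.

(** Both states are brought to the all-zero string and the second circuit is reversed. Reversibility
    keeps both scalars nonzero, so their quotient is a legitimate rescaling. *)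
Lemma circuit_universal phi psi x y : phi x != 0 -> psi y != 0 -> circuit phi psi.
Proof.
move=> phix psiy.
have [c hc] := circuit_to_zero phi; have [c' hc'] := circuit_to_zero psi.
have nz (chi : state) z (e : C) :
    chi z != 0 -> circuit chi (fun x => e * (x == xzero _)%:R) -> e != 0.
  move=> chiz /circuit_sym h; apply: contraNneq chiz => e0.
  by apply/eqP; apply: (circuit_zero h) => t; rewrite e0 mul0r.
have c0 := nz _ _ _ phix hc; have c'0 := nz _ _ _ psiy hc'.
apply: circuit_trans hc _; apply: circuit_trans (circuit_sym hc').
apply: (@circuit_scale (c / c')) => [|t]; last by rewrite mulrA divfK.
by rewrite mulf_neq0 ?invr_eq0.
Qed.

End Circuits.

(** * Computing on the grid *)

Section Grid.
Variable d : nat.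
Hypothesis d_gt0 : (0 < d)%N.
Implicit Types u v : 'I_(d * d).

Definition row v : nat := (v %/ d)%N.
Definition col v : nat := (v %% d)%N.

Lemma dd_gt0 : (0 < d * d)%N.
Proof. by rewrite muln_gt0 d_gt0. Qed.

(** An index outside the grid falls back to vertex 0; the coordinate lemmas ask for [r, c < d]. *)
Definition vtx (r c : nat) : 'I_(d * d) := insubd (Ordinal dd_gt0) (r * d + c)%N.

Lemma val_vtx r c : (r < d)%N -> (c < d)%N -> vtx r c = (r * d + c)%N :> nat.
Proof. by move=> rd cd; rewrite val_insubd; case: ifP => // /negP []; nia. Qed.

Lemma row_vtx r c : (r < d)%N -> (c < d)%N -> row (vtx r c) = r.
Proof. by move=> rd cd; rewrite /row val_vtx // divnMDl // divn_small // addn0. Qed.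

Lemma col_vtx r c : (r < d)%N -> (c < d)%N -> col (vtx r c) = c.
Proof. by move=> rd cd; rewrite /col val_vtx // modnMDl modn_small. Qed.

Lemma vtxP u v : reflect (row u = row v /\ col u = col v) (u == v).
Proof.
apply: (iffP eqP) => [->//|[ruv cuv]]; apply: val_inj => /=.
by rewrite (divn_eq u d) (divn_eq v d) -/(row u) -/(col u) ruv cuv.
Qed.

Lemma eq_vtx v r c : (r < d)%N -> (c < d)%N -> (v == vtx r c) = (row v == r) && (col v == c).
Proof.
move=> rd cd; apply/vtxP/andP; rewrite row_vtx // col_vtx //; first by case=> -> ->.
by case=> /eqP-> /eqP->.
Qed.

Lemma grid_adjE u v : grid_adj u v =
  ((row u == row v) && (((col u).+1 == col v) || ((col v).+1 == col u))) ||
  ((col u == col v) && (((row u).+1 == row v) || ((row v).+1 == row u))).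
Proof. by []. Qed.

End Grid.

Local Ltac split_ifs_lia := repeat (case: ifP => ?); lia.

(** * Running a circuit along the rows of the cluster *)

Section ClusterComputation.
Variables (C : numClosedFieldType) (E : {fset nat}) (m d n : nat).
Variables (L : bool -> lstate C m) (blk : 'I_(d * d) -> m.-tuple nat).
Hypothesis L_norm : forall o, lip (L o) (L o) = 1.
Hypothesis L_orth : lip (L false) (L true) = 0.
Hypothesis blk_uniq : forall v, uniq (blk v).
Hypothesis blk_E : forall v, all (fun q => q \in E) (blk v).
Hypothesis blk_disj : forall u v q,
  q \in (blk u : seq nat) -> q \in (blk v : seq nat) -> u = v.
Hypothesis d_gt0 : (0 < d)%N.
Hypothesis nd : (2 * n <= d)%N.
Variable g : {ffun 'I_(d * d) -> bool} -> C.
Hypothesis g_stab : forall v x,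
  g (xadd x (xone v)) = (-1) ^+ par (nbr (@grid_adj d) v) x * g x.

Implicit Types (phi psi : lstate C n).
Notation vtx := (vtx d_gt0).
Notation converts := (converts E L blk).
Notation gwires := (wires g).

(* Logical qubit [k] travels along row [2k].  A vertex in an odd row and an even
   column bridges two wires; a layer of the computation uses two columns. *)
Definition live t : {set 'I_(d * d)} :=
  [set v | [&& (row v < (2 * n).-1)%N, (2 * t <= col v)%N & ~~ odd (row v) || ~~ odd (col v)]].

(* The bridges in column [2t] are gone and the wires [k < j] have moved to
   column [2t + 2]. *)
Definition moving t j : {set 'I_(d * d)} :=
  [set v | (row v < (2 * n).-1)%N &&
    (if odd (row v) then ~~ odd (col v) && (2 * t < col v)%N
     else (if row v < 2 * j then 2 * t.+1 <= col v else 2 * t <= col v)%N)].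

Definition front t j (k : 'I_n) : 'I_(d * d) :=
  vtx (2 * k) (if (k < j)%N then 2 * t.+1 else 2 * t).

(** Unnormalized [H diag(1, w)] on qubit [k], the gate of one teleportation step. *)
Definition jgate k w phi : lstate C n :=
  fun y => phi (xset k false y) + (-1) ^+ y k * w * phi (xset k true y).

Lemma live_next t : moving t n = live t.+1.
Proof. by apply/setP=> v; rewrite !inE; split_ifs_lia. Qed.

Lemma front_next t : front t n = front t.+1 0.
Proof. by apply: funext => k; rewrite /front ltn_ord. Qed.

(** Two teleportations along row [2j]. No bridges are left in columns [2t] and [2t + 1], so each
    measured vertex has only its right neighbour. *)
Lemma converts_move t (j : 'I_n) w w' phi : (2 * t.+1 < d)%N ->
  w * w^* = 1 -> w' * w'^* = 1 ->
  converts (moving t j) (gwires (front t j) phi)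
    (moving t j.+1) (gwires (front t j.+1) (jgate j w' (jgate j w phi))).
Proof.
move=> td ww ww'.
have rk (k : 'I_n) : (2 * k < d)%N by have := ltn_ord k; lia.
have jn := ltn_ord j; have rj := rk j.
have td1 : (2 * t < d)%N by lia.
have td2 : ((2 * t).+1 < d)%N by lia.
pose v0 := vtx (2 * j) (2 * t); pose v1 := vtx (2 * j) (2 * t).+1.
pose v2 := vtx (2 * j) (2 * t.+1).
pose io1 k := if k == j then v1 else front t j k.
have D2 : moving t j.+1 = (moving t j :\ v0) :\ v1.
  apply/setP=> z; rewrite !inE !eq_vtx //.
  by split_ifs_lia.
have cl (k : 'I_n) e : ((if (k < e)%N then 2 * t.+1 else 2 * t) < d)%N by split_ifs_lia.
apply: (@converts_trans _ _ _ _ _ _ (moving t j :\ v0) (gwires io1 (jgate j w phi))).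
  apply: (@converts_wire _ _ _ _ _ _ _ _ _ _ _ _ _ g_stab _ j v1 v0) => //.
  - by rewrite /front ltnn.
  - by rewrite /io1 eqxx.
  - by move=> k kj; rewrite /io1 (negPf kj).
  - by rewrite !inE row_vtx ?col_vtx //; split_ifs_lia.
  - by rewrite !inE eq_vtx // row_vtx ?col_vtx //; split_ifs_lia.
  - by move=> k; rewrite -val_eqE /= => kj; rewrite eq_vtx // row_vtx //; lia.
  - by move=> k; rewrite eq_vtx // row_vtx ?col_vtx //; split_ifs_lia.
  move=> x sx; rewrite (@par_nbr _ _ _ _ (xone v1) x _ sx) ?par_onel // => z.
  rewrite !inE ffunE !eq_vtx // grid_adjE row_vtx // col_vtx //.
  by split_ifs_lia.
rewrite D2.
apply: (@converts_wire _ _ _ _ _ _ _ _ _ _ _ _ _ g_stab _ j v2 v1) => //.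
- by rewrite /io1 eqxx.
- by rewrite /front ltnSn.
- move=> k; rewrite /io1 => kj; rewrite (negPf kj) /front; move: kj.
  by rewrite -val_eqE /= ltnS leq_eqVlt => /negPf->.
- by rewrite !inE !eq_vtx // row_vtx ?col_vtx //; split_ifs_lia.
- by rewrite !inE !eq_vtx // row_vtx ?col_vtx //; split_ifs_lia.
- move=> k kj; rewrite /io1 (negPf kj) eq_vtx // row_vtx //.
  by move: kj; rewrite -val_eqE /=; lia.
- move=> k; rewrite /io1; case: ifP => kj; rewrite eq_vtx // row_vtx ?col_vtx //; first by lia.
  by move: kj; rewrite -val_eqE /=; lia.
move=> x sx; rewrite (@par_nbr _ _ _ _ (xone v2) x _ sx) ?par_onel // => z.
rewrite !inE ffunE !eq_vtx // grid_adjE row_vtx // col_vtx //.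
by split_ifs_lia.
Qed.

Lemma converts_moves t (phis : nat -> lstate C n) : (2 * t.+1 < d)%N ->
  (forall j : 'I_n, exists w w' c, [/\ w * w^* = 1, w' * w'^* = 1, c != 0 &
     forall y, jgate j w' (jgate j w (phis j)) y = c * phis j.+1 y]) ->
  converts (moving t 0) (gwires (front t 0) (phis 0%N))
    (live t.+1) (gwires (front t.+1 0) (phis n)).
Proof.
move=> td step; rewrite -live_next -front_next.
suff h j : (j <= n)%N -> converts (moving t 0) (gwires (front t 0) (phis 0%N))
    (moving t j) (gwires (front t j) (phis j)) by exact: h.
elim: j => [_|j IH jn]; first exact: converts_refl.
apply: converts_trans (IH (ltnW jn)) _.
have [w [w' [c [ww ww' c0 eqc]]]] := step (Ordinal jn).
have mv := @converts_move t (Ordinal jn) w w' (phis j) td ww ww'.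
apply: (converts_trans mv).
by apply: (@converts_scale _ _ _ _ _ _ _ _ _ c) => // x _; rewrite /wires eqc mulrA.
Qed.

Lemma moving_sub t : moving t 0 \subset live t.
Proof. by apply/subsetP=> v; rewrite !inE muln0 ltn0; split_ifs_lia. Qed.

Lemma front_in t k : (2 * t < d)%N -> front t 0 k \in moving t 0.
Proof.
move=> td; have kn := ltn_ord k.
by rewrite inE row_vtx ?col_vtx //; [split_ifs_lia | lia..].
Qed.

Lemma jgate_id k phi y : jgate k 1 (jgate k 1 phi) y = 2 * phi y.
Proof.
rewrite /jgate !xset_set !ffunE !eqxx.
case yk: (y k); rewrite -[in RHS](xset_id k y) yk /= ?expr1 ?expr0; ring.
Qed.

Lemma converts_local t k w w' c phi psi : (2 * t.+1 < d)%N ->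
  w * w^* = 1 -> w' * w'^* = 1 -> c != 0 ->
  (forall y, jgate k w' (jgate k w phi) y = c * psi y) ->
  converts (live t) (gwires (front t 0) phi) (live t.+1) (gwires (front t.+1 0) psi).
Proof.
move=> td ww ww' c0 eqc.
have one1 : (1 : C) * 1^* = 1 by rewrite rmorph1 mulr1.
apply: (@converts_trans _ _ _ _ _ _ (moving t 0) (gwires (front t 0) phi)).
  apply: converts_delete => //; first exact: moving_sub.
  by move=> j; apply: front_in; lia.
(* The logical state changes exactly when wire [k] moves; every other wire receives [H H], which is
   2 times the identity in this normalization. *)
have := @converts_moves t (fun j => if (j <= k)%N then phi else psi) td.
rewrite [(n <= k)%N]leqNgt ltn_ord /=; apply=> j.
have [->|jk] := eqVneq j k.
  by exists w, w', c; split=> // y; rewrite leqnn ltnn eqc.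
exists 1, 1, 2; split=> // [|y]; first by rewrite pnatr_eq0.
rewrite jgate_id; move: jk; rewrite -val_eqE /= => jk.
by rewrite [(j <= k)%N]leq_eqVlt (negPf jk).
Qed.

(** Of the bridges in column [2t] only the one between rows [2k] and [2k + 2] is kept. Its surviving
    neighbours are the current ends of the two wires, so its measurement couples them, after which
    all wires idle through the layer. *)
Lemma converts_zz t (k l : 'I_n) w phi : (2 * t.+1 < d)%N -> l = k.+1 :> nat -> w * w^* = 1 ->
  converts (live t) (gwires (front t 0) phi)
    (live t.+1) (gwires (front t.+1 0) (phase (xadd (xone k) (xone l)) w phi)).
Proof.
move=> td kl ww; have ln := ltn_ord l.
have rv : ((2 * k).+1 < d)%N by lia.
have rk : (2 * k < d)%N by lia.
have rl : (2 * l < d)%N by lia.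
have td1 : (2 * t < d)%N by lia.
pose v := vtx (2 * k).+1 (2 * t).
have vmov : v \notin moving t 0 by rewrite inE row_vtx ?col_vtx //; split_ifs_lia.
have one1 : (1 : C) * 1^* = 1 by rewrite rmorph1 mulr1.
apply: (@converts_trans _ _ _ _ _ _ (v |: moving t 0) (gwires (front t 0) phi)).
  apply: converts_delete => //.
    rewrite subUset moving_sub andbT sub1set inE row_vtx ?col_vtx //; lia.
  by move=> j; rewrite inE front_in ?orbT.
apply: (@converts_trans _ _ _ _ _ _ (moving t 0)
   (gwires (front t 0) (phase (xadd (xone k) (xone l)) w phi))).
  rewrite -{2}(setU1K vmov).
  apply: (@converts_phase _ _ _ _ _ _ _ _ _ _ _ _ _ g_stab _ v _ _ _ _ w) => //.
  - by rewrite setU11.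
  - by move=> j; rewrite eq_vtx // row_vtx //; have := ltn_ord j; lia.
  rewrite setU1K // => x sx; rewrite /phase parDl !par_onel !ffunE.
  rewrite (@par_nbr _ _ _ _ (xadd (xone (front t 0 k)) (xone (front t 0 l))) x _ sx).
    by rewrite parDl !par_onel.
  move=> z; rewrite !inE !ffunE /front !eq_vtx // grid_adjE row_vtx // col_vtx //.
  by split_ifs_lia.
set psi := phase _ _ _.
apply: (@converts_moves t (fun=> psi) td) => j; exists 1, 1, 2; split=> // [|y].
  by rewrite pnatr_eq0.
exact: jgate_id.
Qed.

Lemma converts_circ c t phi psi : circ c phi psi -> (2 * (t + c) < d)%N ->
  converts (live t) (gwires (front t 0) phi) (live (t + c)) (gwires (front (t + c) 0) psi).
Proof.
have one1 : (1 : C) * 1^* = 1 by rewrite rmorph1 mulr1.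
move=> h; elim: h t => {c phi psi}
  [c phi c0|k w phi ww|k l w phi kl ww|k w phi ww|c1 c2 phi psi chi _ h1 _ h2] t.
- rewrite addn0 => _; apply: (@converts_scale _ _ _ _ _ _ _ _ _ c^-1).
    by rewrite invr_eq0.
  by move=> x _; rewrite /wires mulrA mulKf.
- rewrite addn1 => td; apply: (@converts_local t k (w^* * w^*) 1 (2 * w^*)) => //.
  + by rewrite rmorphM /= mulrACA !unit_conj // mulr1.
  + by rewrite mulf_neq0 ?pnatr_eq0 // conjC_eq0 unit_neq0.
  move=> y; rewrite /jgate /phase par_onel !xset_set !ffunE !eqxx.
  have wwc : w^* * w = 1 by rewrite mulrC.
  case yk: (y k); rewrite -[in RHS](xset_id k y) yk /= ?expr1 ?expr0.
    ring.
  by transitivity (2 * (w^* * w) * phi (xset k false y)); [rewrite wwc|]; ring.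
- by rewrite addn1 => td; apply: converts_zz.
(* First [H], then [H diag(1, w)]: exactly [xrot]. *)
- rewrite addn1 => td; apply: (@converts_local t k 1 w 1) => //; first exact: oner_neq0.
  move=> y; rewrite mul1r /jgate /xrot !xset_set !ffunE !eqxx -xset_neg.
  case yk: (y k); rewrite -[phi y](congr1 phi (xset_id k y)) yk /= ?expr1 ?expr0; ring.
- rewrite addnA => td.
  have td1 : (2 * (t + c1) < d)%N by lia.
  by apply: (converts_trans (h1 t td1)); apply: h2.
Qed.

(** The cluster state is the wire state whose inputs are all |+>, that is, the constant logical
    vector. After the circuit everything except the output vertices is deleted. *)
Lemma converts_cluster c phi : circ c (fun=> 1) phi -> (2 * c < d)%N ->
  converts [set: 'I_(d * d)] g [set front c 0 k | k : 'I_n] (gwires (front c 0) phi).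
Proof.
move=> hc cd.
apply: (@converts_trans _ _ _ _ _ _ [set: 'I_(d * d)] (gwires (front 0 0) (fun=> 1))).
  apply: (@converts_scale _ _ _ _ _ _ _ _ _ 1); first exact: oner_neq0.
  by move=> x _; rewrite /wires !mul1r.
apply: (@converts_trans _ _ _ _ _ _ (live 0) (gwires (front 0 0) (fun=> 1))).
  apply: converts_delete => // k.
  by apply: (subsetP (moving_sub 0)); apply: front_in; rewrite muln0.
apply: (@converts_trans _ _ _ _ _ _ (live c) (gwires (front c 0) phi)).
  exact: (@converts_circ c 0).
apply: converts_delete => //.
  apply/subsetP=> v /imsetP[k _ ->].
  by apply: (subsetP (moving_sub c)); apply: front_in.
by move=> k; apply: imset_f.
Qed.

Lemma front_inj c : (2 * c < d)%N -> injective (front c 0).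
Proof.
move=> cd j k /(congr1 (@row d)).
have rk (i : 'I_n) : (2 * i < d)%N by have := ltn_ord i; lia.
by rewrite !row_vtx // => h; apply: val_inj => /=; lia.
Qed.

Lemma front_indep c u v : (2 * c < d)%N ->
  u \in [set front c 0 k | k : 'I_n] -> v \in [set front c 0 k | k : 'I_n] ->
  grid_adj u v = false.
Proof.
move=> cd /imsetP[j _ ->] /imsetP[k _ ->].
have rk (i : 'I_n) : (2 * i < d)%N by have := ltn_ord i; lia.
by rewrite grid_adjE !row_vtx // !col_vtx //; lia.
Qed.

End ClusterComputation.

(** * Logical Pauli operators and cluster states *)

Section PauliStrings.
Variables (C : numClosedFieldType) (n : nat).
Implicit Types (phi : lstate C n) (k : 'I_n) (ps : n.-tuple 'I_4).

Lemma lapply1E U k phi x : lapply1 U k phi x =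
  U (b2o (x k)) ord0 * phi (xset k false x) + U (b2o (x k)) ord_max * phi (xset k true x).
Proof.
rewrite /lapply1 !big_ord_recl big_ord0 addr0.
by congr (_ + U _ _ * _); apply: val_inj.
Qed.

Definition pauli_x ps : {ffun 'I_n -> bool} :=
  [ffun k => (val (tnth ps k) == 1%N) || (val (tnth ps k) == 2%N)].
Definition pauli_z ps : {ffun 'I_n -> bool} := [ffun k => (2 <= val (tnth ps k))%N].

Definition xmask (s : seq 'I_n) (a : {ffun 'I_n -> bool}) : {ffun 'I_n -> bool} :=
  [ffun k => (k \in s) && a k].

Lemma lapply1_pauli ps k : exists2 c : C, c != 0 & forall phi x,
  lapply1 (pauli C (tnth ps k)) k phi x =
  c * pstring (xmask [:: k] (pauli_x ps)) (xmask [:: k] (pauli_z ps)) phi x.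
Proof.
have mk a : xmask [:: k] a = if a k then xone k else xzero _.
  apply/ffunP=> j; rewrite !ffunE inE.
  by case ak: (a k); rewrite !ffunE; case: eqP => // ->.
rewrite !mk !ffunE.
(* [Y = - i Z X]; the other three operators need no scalar. *)
have ci : - 'i != 0 :> C by rewrite oppr_eq0 neq0Ci.
case: (tnth ps k) => [[|[|[|[|//]]]] ?]; [exists 1|exists 1|exists (- 'i)|exists 1];
  rewrite ?oner_neq0 // => phi x; rewrite lapply1E /pauli /= /pstring ?par0l ?par_onel ?xadd0 -?xset_neg;
  rewrite !mxE -?val_eqE; case xk: (x k) => /=;
  rewrite -?[phi x](congr1 phi (xset_id k x)) ?xk ?expr1 ?expr0; ring.
Qed.

(** Induction over the qubits, where [xmask] cuts the string down to those already treated; the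
    signs from [pstringM] do not depend on the state. *)
Lemma apply_paulisE ps : exists2 c : C, c != 0 & forall phi,
  apply_paulis ps phi = fun x => c * pstring (pauli_x ps) (pauli_z ps) phi x.
Proof.
have full a : xmask (enum 'I_n) a = a by apply/ffunP=> k; rewrite ffunE mem_enum.
rewrite -(full (pauli_x ps)) -(full (pauli_z ps)) /apply_paulis.
elim: (enum 'I_n) (enum_uniq 'I_n) => [_|k s IH /= /andP[ks us]].
  exists 1; first exact: oner_neq0.
  move=> phi; apply: funext => x; rewrite mul1r /=.
  have m0 a : xmask [::] a = xzero _ by apply/ffunP=> j; rewrite !ffunE.
  by rewrite !m0 pstring0.
have [c c0 hc] := IH us; have [c' c'0 hc'] := lapply1_pauli ps k.
have mS a : xmask (k :: s) a = xadd (xmask [:: k] a) (xmask s a).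
  apply/ffunP=> j; rewrite !ffunE !inE; have [->|//] := eqVneq j k.
  by rewrite (negPf ks) addbF.
exists (c * c' * (-1) ^+ par (xmask s (pauli_z ps)) (xmask [:: k] (pauli_x ps))).
  by rewrite !mulf_neq0 ?signr_eq0.
move=> phi; apply: funext => x; rewrite hc hc' !mS -[RHS]mulrA -pstringM /pstring; ring.
Qed.

Lemma pauli_surj (a b : {ffun 'I_n -> bool}) :
  exists ps, pauli_x ps = a /\ pauli_z ps = b.
Proof.
pose code k : nat := if a k then (if b k then 2 else 1) else (if b k then 3 else 0).
have code4 k : (code k < 4)%N by rewrite /code; case: (a k); case: (b k).
exists [tuple Ordinal (code4 k) | k < n]; split; apply/ffunP=> k;
  by rewrite ffunE tnth_mktuple /= /code; case: (a k); case: (b k).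
Qed.

End PauliStrings.

(** * Stabilizer equations and existence of cluster states *)

Section ClusterStates.
Variables (C : numClosedFieldType) (d : nat).
Implicit Types (phi : lstate C (d * d)) (a : 'I_(d * d)) (x : {ffun 'I_(d * d) -> bool}).
Notation nb := (nbr (@grid_adj d)).

Lemma grid_adj_irr a : grid_adj a a = false.
Proof. by rewrite grid_adjE; lia. Qed.

Lemma grid_adj_sym a b : @grid_adj d a b = grid_adj b a.
Proof. by rewrite !grid_adjE; lia. Qed.

Lemma par_nbr_toggle a x : par (nb a) (xadd x (xone a)) = par (nb a) x.
Proof. by rewrite parD par_one ffunE grid_adj_irr addbF. Qed.

Lemma cluster_stabE a phi x :
  cluster_stab a phi x = (-1) ^+ par (nb a) x * phi (xadd x (xone a)).
Proof.
have zs s y : foldr (fun b acc => lapply1 (sigma_z C) b acc) phi s y =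
    (-1) ^+ (\big[addb/false]_(b <- s) y b) * phi y.
  elim: s => [|b s IH]; first by rewrite big_nil mul1r.
  rewrite /= lapply1E !mxE big_cons signr_addb -mulrA -IH -?val_eqE.
  by case yb: (y b) => /=; rewrite -[in RHS](xset_id b y) yb ?expr1 ?expr0; ring.
rewrite /cluster_stab lapply1E zs !mxE /b2o -?val_eqE.
(* The outer [sigma_x] makes the signs be read at the flipped string; they agree since [a] is not
   its own neighbour. *)
transitivity ((-1) ^+ par (nb a) (xadd x (xone a)) * phi (xadd x (xone a))); last first.
  by rewrite par_nbr_toggle.
have parE (y : {ffun 'I_(d * d) -> bool}) :
    \big[addb/false]_(b <- [seq b <- enum 'I_(d * d) | grid_adj a b]) y b = par (nb a) y.
  rewrite big_filter big_enum_cond /= big_mkcond /=; apply: eq_bigr => b _.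
  by rewrite ffunE; case: grid_adj.
rewrite -xset_neg zs !parE; case: (x a) => /=; ring.
Qed.

Lemma is_cluster_stab phi : is_cluster phi -> forall a x,
  phi (xadd x (xone a)) = (-1) ^+ par (nb a) x * phi x.
Proof.
move=> [_ stab] a x; rewrite -{2}(stab a) cluster_stabE mulrA -signr_addb addbb mul1r //.
Qed.

Definition edge_count (x : {ffun 'I_(d * d) -> bool}) : nat :=
  (\sum_u \sum_v [&& grid_adj u v, x u & x v])%N.

(* Every edge is counted twice, whence the base ['i] instead of [-1]. *)
Definition graph_sign (x : {ffun 'I_(d * d) -> bool}) : C := 'i ^+ edge_count x.

Lemma edge_count_set a x : x a = false ->
  edge_count (xset a true x) = (edge_count x + 2 * \sum_v (grid_adj a v && x v))%N.
Proof.
move=> xa; pose e u v := [&& @grid_adj d u v, x u & x v].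
have -> : edge_count x = (\sum_(u | u != a) \sum_(v | v != a) e u v)%N.
  rewrite /edge_count (bigD1 a) //= big1 ?add0n; last by move=> v _; rewrite xa andbF.
  by apply: eq_bigr => u ua; rewrite (bigD1 a) //= xa !andbF.
have sa : (\sum_v (grid_adj a v && x v) = \sum_(v | v != a) (grid_adj a v && x v))%N.
  by rewrite (bigD1 a) //= xa andbF.
rewrite /edge_count (bigD1 a) //= (bigD1 a) //= grid_adj_irr add0n.
rewrite mul2n -addnn sa addnA addnC; congr (_ + _)%N; last first.
  by apply: eq_bigr => v va; rewrite !ffunE eqxx (negPf va).
rewrite -big_split /=; apply: eq_bigr => u ua.
rewrite (bigD1 a) //= !ffunE eqxx (negPf ua) andbT grid_adj_sym addnC; congr (_ + _)%N.
by apply: eq_bigr => v va; rewrite !ffunE (negPf va).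
Qed.

Lemma graph_sign_set a x : x a = false ->
  graph_sign (xset a true x) = (-1) ^+ par (nb a) x * graph_sign x.
Proof.
move=> xa; rewrite /graph_sign edge_count_set // exprD mulrC exprM sqrCi.
rewrite -[X in X * _ = _]signr_odd (big_morph odd oddD (erefl _)); congr ((-1) ^+ nat_of_bool _ * _).
by apply: eq_bigr => v _; rewrite ffunE oddb.
Qed.

Lemma graph_sign_stab a x :
  graph_sign (xadd x (xone a)) = (-1) ^+ par (nb a) x * graph_sign x.
Proof.
case xa: (x a); last first.
  by rewrite -graph_sign_set //; congr graph_sign; rewrite -xset_neg xa.
pose y := xadd x (xone a).
have ya : y a = false by rewrite !ffunE xa eqxx.
have xE : x = xset a true y by rewrite -{1}(xaddK x (xone a)) -/y -xset_neg ya.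
rewrite -/y {2}xE graph_sign_set // mulrA -signr_addb {1}xE.
have -> : par (nb a) (xset a true y) = par (nb a) y.
  by rewrite par_xset // ffunE grid_adj_irr addbF.
by rewrite addbb mul1r.
Qed.

(** Universality only concerns given states, so an actual cluster state has to be exhibited: the
    signs of the graph, divided by the root of the number of strings. *)
Lemma cluster_exists : exists phi, is_cluster phi.
Proof.
pose N : C := (2 ^ (d * d))%:R.
have N0 : 0 < N by rewrite ltr0n expn_gt0.
pose r := (sqrtC N)^-1.
exists (fun x => r * graph_sign x); split=> [|a].
  rewrite /lnormalized.
  under eq_bigr do rewrite normrM /graph_sign normrX normCi expr1n mulr1.
  rewrite sumr_const card_ffun card_bool card_ord /r normfV ger0_norm ?sqrtC_ge0 ?ltW //.
  by rewrite exprVn sqrtCK -mulr_natr mulVf // gt_eqF.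
apply: funext => x; rewrite cluster_stabE graph_sign_stab mulrCA; congr (_ * _).
by rewrite mulrA -signr_addb addbb mul1r.
Qed.

End ClusterStates.

(** * Encoded states as partial encodings of the grid *)

Section EncodedStates.
Variables (C : numClosedFieldType) (F : enc_family C) (V : finType) (n : nat).
Variables (blk : V -> (ef_m F).-tuple nat) (io : 'I_n -> V).
Hypothesis io_inj : injective io.
Let L (o : bool) := if o then @ef_L1 C F else @ef_L0 C F.
Let D := [set io k | k : 'I_n].

Lemma enc_state_penc (A : n.-tuple ((ef_m F).-tuple nat)) (phi : lstate C n) :
  (forall k, tnth A k = blk (io k)) ->
  enc_state A phi = penc L blk D (fun x => phi (pull io x)).
Proof.
move=> AE; apply: funext => S; rewrite /enc_state /penc.
have -> : covered blk D S = all
    (fun q => has (fun b : (ef_m F).-tuple nat => q \in (b : seq nat)) A) (enum_fset S).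
  apply: eq_all => q; apply/existsP/hasP => [[v /andP[/imsetP[k _ ->] qk]]|[b /tnthP[k ->] qk]].
    by exists (tnth A k); rewrite ?mem_tnth // AE.
  by exists (io k); rewrite imset_f // -AE.
case: ifP => // _.
(* Extension by zero inverts [pull io] on strings supported in [D]. *)
pose ext (y : {ffun 'I_n -> bool}) : {ffun V -> bool} := [ffun v => [exists k, (io k == v) && y k]].
have extK y : pull io (ext y) = y.
  apply/ffunP=> k; rewrite !ffunE; apply/existsP/idP => [[j /andP[/eqP/io_inj-> //]]|yk].
  by exists k; rewrite eqxx.
rewrite (reindex_onto (pull io) ext) //.
apply: eq_big => [x|x _]; last first.
  congr (_ * _); rewrite [RHS]big_imset /=; last by move=> j k _ _; apply: io_inj.
  by apply: eq_big => // k _; rewrite ffunE AE.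
rewrite andTb; apply/eqP/suppP => [<- v|sx].
  by rewrite ffunE => /existsP[k /andP[/eqP<- _]]; apply: imset_f.
apply/ffunP=> v; rewrite ffunE; apply/existsP/idP => [[k /andP[/eqP<-]]|xv].
  by rewrite ffunE.
by have /imsetP[k _ vk] := sx v xv; exists k; rewrite -vk eqxx ffunE -vk.
Qed.

Lemma par_pull b x : supp D x -> par (pull io b) (pull io x) = par b x.
Proof.
move=> /suppP sx; rewrite /par [RHS](bigID (mem D)) /= [X in _ (+) X]big1 ?addbF.
  rewrite big_imset /=; last by move=> j k _ _; apply: io_inj.
  by apply: eq_big => // k _; rewrite !ffunE.
by move=> v; apply: contraNF => /andP[_ /sx].
Qed.

End EncodedStates.

(** * From cluster states to universality and back *)

Section Universality.
Variables (C : numClosedFieldType) (E : nat -> {fset nat}) (psi : nat -> qstate C).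
Variable F : enc_family C.
Hypothesis resource : resource_family E psi.
Hypothesis F_consistent : consistent E F.

Lemma universal_cluster : universal E F psi -> cluster_generable E F psi.
Proof.
move=> univ d; have [phi clphi] := cluster_exists C d.
by exists phi; split=> //; apply: univ; case: clphi.
Qed.

Lemma lnormalized_neq0 n (phi : lstate C n) : lnormalized phi -> exists y, phi y != 0.
Proof.
move=> nphi; apply: contrapT => h; move: nphi; rewrite /lnormalized.
rewrite big1 => [/esym/eqP|y _]; first by rewrite oner_eq0.
case: (eqVneq (phi y) 0) => [->|y0]; first by rewrite normr0 expr0n.
by case: h; exists y.
Qed.

Lemma resource_neq0 i : psi i <> (fun _ => 0).
Proof.
move=> psi0; have [_] := resource i; rewrite /normalized_in psi0 big1 => [/esym/eqP|S _].
  by rewrite oner_eq0.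
by rewrite normr0 expr0n.
Qed.

Lemma lip_normalized n (u : lstate C n) : lnormalized u -> lip u u = 1.
Proof. by move=> <-; apply: eq_bigr => x _; rewrite normCK mulrC. Qed.

Lemma cluster_universal : cluster_generable E F psi -> universal E F psi.
Proof.
move=> clus n phi /lnormalized_neq0[y phiy].
have [c hc] := @circuit_universal C n (fun=> 1) phi y y (oner_neq0 _) phiy.
(* Room for the [n] wires in even rows and for the output column [2c]. *)
pose d := (2 * n + 2 * c).+1.
have [g [cl [i [A [AP [uA [p runp]]]]]]] := clus d; exists i.
have d_gt0 : (0 < d)%N by [].
have nd : (2 * n <= d)%N by rewrite /d; lia.
have cd : (2 * c < d)%N by rewrite /d; lia.
pose L (o : bool) := if o then @ef_L1 C F else @ef_L0 C F.
pose blk := tnth A.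
have [N0 [N1 [orth part]]] := F_consistent.
have [[part_in [_ part_disj]] _] := part i.
have L_norm o : lip (L o) (L o) = 1 by case: o; apply: lip_normalized.
have A_inj : injective (tnth A) by apply/tuple_uniqP.
have blk_uniq v : uniq (blk v) by case: (part_in _ (AP v)).
have blk_E v : all (fun q => q \in E i) (blk v) by case: (part_in _ (AP v)).
have blk_disj u v q : q \in (blk u : seq nat) -> q \in (blk v : seq nat) -> u = v.
  move=> qu qv; apply/eqP/negP => /negP uv.
  have Auv : tnth A u != tnth A v by rewrite (inj_eq A_inj).
  by have := part_disj _ _ (AP u) (AP v) Auv q qu; rewrite qv.
have conv := converts_cluster (E := E i) (L := L) L_norm orth blk_uniq blk_E blk_disj
  d_gt0 nd (is_cluster_stab cl) hc cd.
set io := front d_gt0 c 0 in conv.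
have io_inj : injective io by apply: front_inj.
exists [tuple tnth A (io k) | k < n]; split; first by move=> k; rewrite tnth_mktuple.
split; first by apply/tuple_uniqP=> j k; rewrite !tnth_mktuple => /A_inj/io_inj.
set G := (fun chi : qstate C => _).
(* The resource is a unit vector, which excludes the degenerate case of [reaches] and leaves an
   actual protocol. *)
suff [/resource_neq0//|] : reaches (E i) (psi i) G by [].
apply: (runs_bind runp) => chi [k k0 [ps ->]].
have start : up_to_pauli L blk [set: 'I_(d * d)] g
    (fun S => k * enc_state A (apply_paulis ps g) S).
  have [e e0 he] := apply_paulisE C ps.
  exists (k * e), (pauli_x ps), (pauli_z ps); split; first by rewrite mulf_neq0.
    by apply/suppP => v _; rewrite inE.
  apply: funext => S; rewrite -mulrA -penc_scale he.
  rewrite (@enc_state_penc _ _ _ _ blk id) //; congr (_ * penc _ _ _ _ _).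
    by apply/setP=> v; rewrite inE; apply/imsetP; exists v.
  by apply: funext => x; congr (_ * pstring _ _ _ _); apply/ffunP=> v; rewrite ffunE.
apply: reaches_bind (conv _ start) _ => chi' [e [a [b [e0 sa ->]]]].
set D := [set _ | _ in _] in sa *.
have indep u v : u \in D -> v \in D -> grid_adj u v = false by apply: front_indep.
have gE x : supp D x -> g x = g (xzero _).
  exact: (g_independent (is_cluster_stab cl)).
pose a' := pull io a; pose b' := pull io b.
have [ps' [psx psz]] := pauli_surj a' b'.
have [f f0 hf] := apply_paulisE C ps'.
have encE S : penc L blk D (pstring a b (wires g io phi)) S =
    g (xzero _) / f * enc_state [tuple tnth A (io k) | k < n] (apply_paulis ps' phi) S.
  rewrite (@enc_state_penc _ _ _ _ blk io) //; last by move=> j; rewrite tnth_mktuple.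
  rewrite -penc_scale; congr (_ S); apply: penc_eq => x sx.
  rewrite hf psx psz /pstring /wires gE ?supp_add // par_pull //.
  have -> : pull io (xadd x a) = xadd (pull io x) a'.
    by apply/ffunP=> j; rewrite !ffunE.
  by field.
(* The graph amplitude enters as a global scalar; were it zero, the branch would be the zero
   vector. *)
have [g0|g0] := eqVneq (g (xzero _)) 0.
  by left; apply: funext => S; rewrite encE g0 !mul0r mulr0.
apply: reaches_done; exists (e * (g (xzero _) / f)).
  by rewrite !mulf_neq0 ?invr_eq0.
by exists ps'; apply: funext => S; rewrite encE mulrA.
Qed.

End Universality.

Theorem theorem12 (R : realType) (E : nat -> {fset nat})
    (psi : nat -> qstate R[i]) :
  nested E -> resource_family E psi ->
  (forall F : enc_family R[i], consistent E F ->
     (universal E F psi <-> cluster_generable E F psi)) /\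
  ((exists F : enc_family R[i], consistent E F /\ universal E F psi) <->
   (exists F : enc_family R[i], consistent E F /\ cluster_generable E F psi)).
Proof.
move=> _ resource.
have equiv (F : enc_family R[i]) : consistent E F ->
    (universal E F psi <-> cluster_generable E F psi).
  by move=> cF; split; [apply: universal_cluster | apply: cluster_universal].
by split=> //; split=> -[F [cF h]]; exists F; split=> //; apply/equiv.
Qed.
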